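(* Let $n,d$ be integers with $n\ge2$ and $1\le d\le n$. Let $\boldsymbol{k}_1,\dots,\boldsymbol{k}_d,\boldsymbol{l}$ be indices and $\boldsymbol{k}_{d+1},\dots,\boldsymbol{k}_n$ non-empty indices; let $\boldsymbol{z}_i\in\mathbb{D}^{\mathrm{dep}(\boldsymbol{k}_i)}$ ($1\le i\le n$), $\boldsymbol{w}\in\mathbb{D}^{\mathrm{dep}(\boldsymbol{l})}$, and write $P_i=\left({\boldsymbol{z}_i\atop\boldsymbol{k}_i}\right)$, $Q=\left({\boldsymbol{w}\atop\boldsymbol{l}}\right)$. Let $v_1,\dots,v_d\in\mathbb{D}\setminus\{0\}$ and $t\in\mathbb{D}$ satisfy $\frac1{v_1}+\cdots+\frac1{v_d}=t$, and assume that if $n=d=2$ and $\boldsymbol{k}_i=\varnothing$ for some $i\in\{1,2\}$, then $|v_{3-i}|<1$ or $|t|<1$. Then \begin{align*} &\sum_{i=1}^{d}Z_n\left((P_1)_{\overset{v_1}{\longrightarrow}};\dots;P_i;\dots;(P_d)_{\overset{v_d}{\longrightarrow}};(P_{d+1})_{\uparrow};\dots; (P_n)_{\uparrow} \ \middle| \ Q_{\overset{t}{\longrightarrow}}\right)\\ &\quad -\sum_{i=d+1}^nZ_n\left((P_1)_{\overset{v_1}{\longrightarrow}};\dots;(P_d)_{\overset{v_d}{\longrightarrow}};(P_{d+1})_{\uparrow};\dots;P_i;\dots;(P_n)_{\uparrow} \ \middle| \ Q_{\overset{t}{\longrightarrow}}\right)\\ &=-Z_n\left((P_1)_{\overset{v_1}{\longrightarrow}};\dots;(P_d)_{\overset{v_d}{\longrightarrow}};(P_{d+1})_{\uparrow};\dots;(P_n)_{\uparrow}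 \ \middle| \ Q\right), \end{align*} where in each summand only the $i$th slot carries no arrow.
   Context: $\mathbb{D}=\{z\in\mathbb{C}:|z|\le1\}$, $\mathbb{D}^0=\{\varnothing\}$. An index is a finite tuple $\boldsymbol{k}=(k_1,\dots,k_r)$ of positive integers ($r=\mathrm{dep}(\boldsymbol{k})$), possibly empty ($\varnothing$). For $a_i\ge0$, $C(a_1,\dots,a_n)=\frac{a_1!\cdots a_n!}{(a_1+\cdots+a_n)!}$. For indices $\boldsymbol{k}_j=(k^{(j)}_1,\dots,k^{(j)}_{r_j})$, $\boldsymbol{l}=(l_1,\dots,l_s)$ and $\boldsymbol{z}_j=(z^{(j)}_i)\in\mathbb{D}^{r_j}$, $\boldsymbol{w}=(w_i)\in\mathbb{D}^s$, \[ Z_n\left({\boldsymbol{z}_1 \atop \boldsymbol{k}_1};\dots;{\boldsymbol{z}_n \atop \boldsymbol{k}_n} \ \middle| \ {\boldsymbol{w} \atop \boldsymbol{l}}\right)=\sum C(m^{(1)}_{r_1},\dots,m^{(n)}_{r_n})\left[\prod_{j=1}^n\prod_{i=1}^{r_j}\frac{(z^{(j)}_i)^{m^{(j)}_i-m^{(j)}_{i-1}}}{(m^{(j)}_i)^{k^{(j)}_i}}\right]\left[q_s\prod_{i=1}^s\frac{w_i^{q_i-q_{i-1}}}{q_i^{l_i}}\right], \] summed over integers $0=m^{(j)}_0<\cdots<m^{(j)}_{r_j}$ ($1\le j\le n$) and $0=q_0<q_1\le\cdots\le q_s=m^{(1)}_{r_1}+\cdots+m^{(n)}_{r_n}$ (so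 $m^{(j)}_{r_j}=0$ if $\boldsymbol{k}_j=\varnothing$); $Z_n(\cdots\mid{\varnothing\atop\varnothing})=0$. Arrow notation: for $\boldsymbol{k}=(k_1,\dots,k_r)$, $\boldsymbol{k}_{\to}=(k_1,\dots,k_r,1)$, $\boldsymbol{k}_\uparrow=(k_1,\dots,k_{r-1},k_r+1)$, $\varnothing_\to=(1)$, $\varnothing_\uparrow=\varnothing$. For $v\in\mathbb{D}\setminus\{0\}$, $\left({\boldsymbol{z}\atop\boldsymbol{k}}\right)_{\overset{v}{\longrightarrow}}=\left({(\boldsymbol{z},v)\atop\boldsymbol{k}_\to}\right)$; $\left({\boldsymbol{z}\atop\boldsymbol{k}}\right)_{\overset{0}{\longrightarrow}}=\left({\boldsymbol{z}\atop\boldsymbol{k}}\right)_\uparrow=\left({\boldsymbol{z}\atop\boldsymbol{k}_\uparrow}\right)$. *)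

(* Defs.v *)
From mathcomp Require Import all_boot all_order all_algebra.
From mathcomp Require Import all_classical all_reals all_analysis.
From mathcomp Require Import complex.
From mathcomp.analysis.showcase Require summability.

Set Implicit Arguments.
Unset Strict Implicit.
Unset Printing Implicit Defensive.

Import Order.TTheory GRing.Theory Num.Theory.
Local Open Scope ring_scope.

(* An index k with arguments z in D^(dep k) is the sequence of its columns
   (z_1, k_1), ..., (z_r, k_r); the empty index is [::]. *)
Notation argindex R := (seq (R[i] * nat)).

Definition is_argindex (R : realType) (P : argindex R) : bool :=
  all (fun c => (`|c.1| <= 1) && (0 < c.2)%N) P.

Fixpoint idx_up (R : realType) (P : argindex R) : argindex R :=
  match P with
  | [::] => [::]
  | [:: (z, k)] => [:: (z, k.+1)]
  | c :: P' => c :: idx_up P'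
  end.

Definition idx_arrow (R : realType) (v : R[i]) (P : argindex R) : argindex R :=
  if v == 0 then idx_up P else rcons P (v, 1%N).

Section Z.
Variables (R : realType) (n : nat).
Implicit Types (P : 'I_n -> argindex R) (Q : argindex R).

(* A summation index: the n sequences (m^(j)_1, ..., m^(j)_(r_j)) and the
   sequence (q_1, ..., q_s). With m_0 = q_0 = 0 prepended, the 1-based entry x_i
   of a sequence s is nth 0 (0 :: s) i, and its final entry is last 0 s. *)
Definition Zidx : Type := ({ffun 'I_n -> seq nat} * seq nat)%type.

Definition Zdom P Q (c : Zidx) : bool :=
  [&& [forall j, (size (c.1 j) == size (P j)) && path ltn 0 (c.1 j)],
      size c.2 == size Q, path leq 1 c.2
    & last 0 c.2 == \sum_j last 0 (c.1 j)]%N.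

Definition Cfact (a : 'I_n -> nat) : R[i] :=
  (\prod_j (a j)`!)%N%:R / ((\sum_j a j)`!)%N%:R.

Definition chain_prod (P : argindex R) (m : seq nat) : R[i] :=
  \prod_(i < size P)
    ((nth (0, 0%N) P i).1
        ^+ (nth 0%N (0%N :: m) i.+1 - nth 0%N (0%N :: m) i)
      / (nth 0%N (0%N :: m) i.+1)%:R ^+ (nth (0, 0%N) P i).2).

Definition Zterm P Q (c : Zidx) : R[i] :=
  Cfact (fun j => last 0%N (c.1 j)) * (\prod_j chain_prod (P j) (c.1 j))
    * ((last 0%N c.2)%:R * chain_prod Q c.2).

(* The multiple series is the unordered sum (limit of the sums over finite sets
   of indices); R[i]^o carries the topology of the modulus. *)
Definition Zn P Q : R[i] :=
  if Q is [::] then 0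
  else summability.sum
         (fun c : Zidx => (if Zdom P Q c then Zterm P Q c else 0) : R[i]^o).

Definition Zn_abs_cvg P Q : Prop :=
  esum.summable [set c : Zidx | Zdom P Q c]%classic
    (fun c => (complex.Re `|Zterm P Q c|)%:E).

End Z.

(* Main.v *)
(** Let [f_j(m)] be the sum of the chain products of [P_j] over the chains ending
    in [m], let [psi_j(m)] be [m!] times the same sum for the arrowed [P_j], and
    let [G(q)] be [q] times the corresponding sum for the arrowed [Q].  Then
    [m! f_j(m) = psi_j(m+1) / v_j - m psi_j(m)] for [j <= d] and
    [m! f_j(m) = m psi_j(m)] for [j > d].  Writing [Psi_M] for the sum of
    [psi_1(m_1) ... psi_n(m_n)] over [m_1 + ... + m_n = M], the alternating sum of
    the [n] series on the left, restricted to total [M], is therefore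
    [(t Psi_(M+1) - M Psi_M) G(M) / M!].  Since [G(q) - t G(q-1)] is the chain sum
    of [Q] itself, the sum over [M <= N] telescopes to minus the truncated right
    side plus the boundary term [t Psi_(N+1) G(N) / N!].

    All chain sums are [O(L(m)^r / m)] with [L(m) = 1 + H_m], and the sum of
    [(m_1 - 1)! ... (m_n - 1)!] over [m_1 + ... + m_n = M] is [O((M-2)!)] when
    [n >= 2].  As every power of [L] is [O(sqrt m)], this gives absolute
    convergence and makes the boundary term vanish in the limit.  Only for [n = 2]
    with an empty slot is a factor [1/M] missing; it is supplied by [P_j] up when
    [d = 1], and by the geometric decay due to [|v_j| < 1] or [|t| < 1] when
    [d = 2]. *)

Require Import Defs.
From mathcomp Require Import all_boot all_order all_algebra.
From mathcomp Require Import all_classical all_reals all_analysis.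
From mathcomp Require Import complex finmap ring lra.
Import Order.TTheory GRing.Theory Num.Theory.
Import numFieldNormedType.Exports.
Local Open Scope ring_scope.

Set Implicit Arguments.
Unset Strict Implicit.

(** * Unordered sums exhausted by boxes *)

Lemma ler_sum_sub_seq (F : numDomainType) (I : eqType) (s t : seq I) (f : I -> F) :
  uniq s -> uniq t -> {subset s <= t} -> (forall i, i \in t -> 0 <= f i) ->
  \sum_(i <- s) f i <= \sum_(i <- t) f i.
Proof.
move=> us ut st f0; rewrite [leRHS](bigID (mem s)) /= -[X in _ <= X + _]big_filter.
rewrite [X in _ <= X + _](perm_big s); last first.
  apply: uniq_perm; rewrite ?filter_uniq // => i; rewrite mem_filter.
  by apply/andP/idP => [[]//|si]; split => //; exact: st.
by rewrite lerDl big_seq_cond sumr_ge0 // => i /andP[/f0].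
Qed.

Section UnorderedSums.
Variable R : realType.
Implicit Types z : R[i].

Lemma ReE_norm z : (complex.Re `|z|)%:C%C = `|z|.
Proof. by rewrite RRe_real // normr_real. Qed.

Lemma normci : `|'i%C : R[i]| = 1.
Proof. by rewrite normc_def /= expr0n expr1n add0r sqrtr1. Qed.

Lemma norm_le_ReIm z : `|z| <= (`|complex.Re z| + `|complex.Im z|)%:C%C.
Proof.
rewrite {1}[z]complexE (le_trans (ler_normD _ _)) // rmorphD /= lerD //.
  by rewrite normc_def /= expr0n /= addr0 sqrtr_sqr.
by rewrite normrM normci mul1r normc_def /= expr0n /= addr0 sqrtr_sqr.
Qed.

Lemma Im_le_norm z : `|complex.Im z|%:C%C <= `|z|.
Proof. by have := normc_ge_Re (z * 'i%C); rewrite ReiNIm normrN normrM normci mulr1. Qed.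

Lemma cvg_complex (u : nat -> R[i]^o) (z : R[i]^o) :
  ((fun n => complex.Re (u n)) @ \oo --> complex.Re z)%classic ->
  ((fun n => complex.Im (u n)) @ \oo --> complex.Im z)%classic ->
  (u @ \oo --> z)%classic.
Proof.
move=> /cvgrPdist_lt hr /cvgrPdist_lt hi; apply/cvgrPdist_lt => e e0.
have er : e = (complex.Re e)%:C%C by rewrite RRe_real // gtr0_real.
have e20 : 0 < complex.Re e / 2 by rewrite divr_gt0 // -ltcR -er.
have := hr _ e20; have := hi _ e20; apply: filterS2 => n hi' hr'.
rewrite (le_lt_trans (norm_le_ReIm _)) // er ltcR (splitr (complex.Re e)).
by rewrite !raddfB /= in hi' hr' *; rewrite ltrD.
Qed.

Variables (I : choiceType) (x : I -> R[i]) (D : pred I) (h : I -> nat).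
Variables (b : nat -> seq I) (B : R).
Hypothesis bu : forall N, uniq (b N).
Hypothesis bE : forall N i, (i \in b N) = D i && (h i <= N)%N.
Hypothesis bB : forall N, \sum_(i <- b N) `|x i| <= B%:C%C.

Let A N := \sum_(i <- b N) complex.Re `|x i|.

Let sub_b N M : (N <= M)%N -> {subset b N <= b M}.
Proof. by move=> NM i; rewrite !bE => /andP[-> /leq_trans->]. Qed.

Let AB N : A N <= B.
Proof.
rewrite -lecR; apply: le_trans (bB N); rewrite rmorph_sum /=.
by apply: ler_sum => i _; rewrite ReE_norm.
Qed.

Let Re_ge0 z : 0 <= complex.Re `|z|.
Proof. by rewrite -ler0c ReE_norm. Qed.

(** Monotone convergence suffices: [g i] is the difference of the nonnegative [g i + |x i|] and
    [|x i|], whose box sums both increase and stay bounded. *)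
Let cvgn_monotone (g : I -> R) : (forall i, `|g i| <= complex.Re `|x i|) ->
  cvgn (fun N => \sum_(i <- b N) g i).
Proof.
move=> gx.
have gpos i : 0 <= g i + complex.Re `|x i|.
  by rewrite -lerBlDr sub0r; have := gx i; rewrite ler_norml => /andP[].
have cA : cvgn A.
  apply: nondecreasing_is_cvgn => [N M NM|]; first exact: ler_sum_sub_seq (sub_b NM) _.
  by exists B => _ [N _ <-]; exact: AB.
have c2 : cvgn (fun N => \sum_(i <- b N) (g i + complex.Re `|x i|)).
  apply: nondecreasing_is_cvgn => [N M NM|]; first exact: ler_sum_sub_seq (sub_b NM) _.
  exists (B + B) => _ [N _ <-]; rewrite big_split /= lerD ?AB //.
  by apply: le_trans (AB N); apply: ler_sum => i _; rewrite (le_trans _ (gx i)) // ler_norm.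
rewrite (_ : (fun N => _) = (fun N => \sum_(i <- b N) (g i + complex.Re `|x i|)) - A).
  exact: is_cvgB.
by apply/funext => N; rewrite !fctE big_split /= addrK.
Qed.

Let cvgA : cvgn A.
Proof. by apply: cvgn_monotone => i; rewrite ger0_norm. Qed.

Let A_le N : A N <= limn A.
Proof.
apply: nondecreasing_cvgn_le => // N' M NM; exact: ler_sum_sub_seq (sub_b NM) _.
Qed.

Lemma sum_box_norm_le (s : seq I) : uniq s -> {subset s <= D} ->
  \sum_(i <- s) complex.Re `|x i| <= B.
Proof.
move=> us sD; apply: le_trans (AB (\max_(i <- s) h i)); apply: ler_sum_sub_seq => // i si.
by rewrite bE leq_bigmax_seq // andbT; exact: sD.
Qed.

Lemma summable_box :
  esum.summable [set i | D i]%classic (fun i => (complex.Re `|x i|)%:E).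
Proof.
rewrite /esum.summable; apply: (@le_lt_trans _ _ B%:E); last exact: ltry.
apply: ge_ereal_sup => _ [F [finF FD] <-].
rewrite fsbig_finite //=.
rewrite sumEFin lee_fin.
apply: (@le_trans _ _ (\sum_(i <- fset_set F) complex.Re `|x i|)).
  by apply: ler_sum => i _; rewrite ger0_norm //; exact: Re_ge0.
apply: sum_box_norm_le => // i; rewrite in_fset_set // => /set_mem; exact: FD.
Qed.

(** A finite set containing [b N] differs from it by terms of [D] above height [N] and by zeros
    outside [D], so the two sums differ by at most the tail [limn A - A N]. *)
Lemma cvgn_sum_box :
  ((fun N => \sum_(i <- b N) x i : R[i]^o) @ \oo -->
   summability.sum (fun i => (if D i then x i else 0) : R[i]^o))%classic.
Proof.
have cR : cvgn (fun N => \sum_(i <- b N) complex.Re (x i)).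
  by apply: cvgn_monotone => i; rewrite -lecR ReE_norm normc_ge_Re.
have cI : cvgn (fun N => \sum_(i <- b N) complex.Im (x i)).
  by apply: cvgn_monotone => i; rewrite -lecR ReE_norm Im_le_norm.
set l : R[i]^o := (limn (fun N => \sum_(i <- b N) complex.Re (x i)) +i*
         limn (fun N => \sum_(i <- b N) complex.Im (x i)))%C.
have cl : ((fun N => \sum_(i <- b N) x i : R[i]^o) @ \oo --> l)%classic.
  apply: cvg_complex => /=; under eq_fun do rewrite raddf_sum /=; [exact: cR|exact: cI].
suff -> : summability.sum (fun i => (if D i then x i else 0) : R[i]^o) = l by [].
apply: cvg_lim; first exact: norm_hausdorff.
  exact: summability.totally_filter.
apply/cvgrPdist_lt; first exact: summability.totally_filter.
move=> e e0.
have e20 : 0 < e / 2 by rewrite divr_gt0.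
have er : e / 2 = (complex.Re (e / 2))%:C%C by rewrite RRe_real // gtr0_real.
move/cvgrPdist_lt: cl => /(_ _ e20).
have /cvgrPdist_lt/(_ (complex.Re (e / 2))) := cvgA; rewrite -ltcR -er => /(_ e20).
move=> hA hl; have [N _ /(_ N (leqnn N)) [AN lN]] := filterI hA hl.
exists [fset i in b N]%fset => // J /= /fsubsetP bJ.
rewrite /summability.partial_sum -(big_seq_fsetE _ _ predT (fun i => if D i then x i else 0)) /=.
rewrite -big_mkcond /= (bigID (fun i => (h i <= N)%N)) /=.
rewrite -big_filter (perm_big (b N)); last first.
  apply: uniq_perm; rewrite ?filter_uniq // => i; rewrite mem_filter -bE.
  by apply/andP/idP => [[]//|bi]; split => //; apply: bJ; rewrite inE.
rewrite opprD addrA (le_lt_trans (ler_normB _ _)) // [ltRHS]splitr ltrD //.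
apply: (@le_lt_trans _ _ (limn A - A N)%:C%C); last first.
  by rewrite er ltcR; apply: le_lt_trans AN; exact: ler_norm.
rewrite -big_filter (le_trans (ler_norm_sum _ _ _)) //.
under eq_bigr do rewrite -ReE_norm.
rewrite -rmorph_sum /= lecR lerBrDr.
set s := [seq _ <- _ | _].
have us : uniq (s ++ b N).
  rewrite cat_uniq filter_uniq ?fset_uniq // bu andbT /=.
  by apply/hasPn => i; rewrite bE => /andP[Di hi]; rewrite mem_filter hi /= andbF.
(* Box [M] contains the extra terms together with [b N], so their absolute sum is at most [A M],
   hence at most [limn A]. *)
pose M := \max_(i <- s ++ b N) h i.
rewrite /A -big_cat; apply: le_trans (A_le M).
apply: ler_sum_sub_seq => [//|//|i si|i _]; last exact: Re_ge0.
rewrite bE leq_bigmax_seq // andbT.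
by move: si; rewrite mem_cat mem_filter bE => /orP[/andP[/andP[]]|/andP[]].
Qed.

End UnorderedSums.

(** * Chain sums *)

(* The possible predecessors of an entry [m] of a chain: [w = false] gives the
   strict chains [0 < m_1 < ... < m_r], [w = true] the weak chains
   [1 <= q_1 <= ... <= q_s]; in both cases the chain is started at [0]. *)
Definition pred_range (w : bool) (m : nat) : seq nat :=
  if (0 < m)%N then iota 0 (m + w) else [::].

Lemma mem_pred_range w m a : (a \in pred_range w m) = (0 < m)%N && (a < m + w)%N.
Proof. by rewrite /pred_range; case: ltnP => _; rewrite ?mem_iota. Qed.

Lemma pred_range_uniq w m : uniq (pred_range w m).
Proof. by rewrite /pred_range; case: ltnP => _; rewrite ?iota_uniq. Qed.

(** Chains are grown at the end, because both arrows act on the last column; the empty chain ends in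
    [0], in accordance with [last 0 [::] = 0]. *)
Fixpoint chains (w : bool) (r m : nat) : seq (seq nat) :=
  if r is r'.+1 then [seq rcons s m | a <- pred_range w m, s <- chains w r' a]
  else if m == 0%N then [:: [::]] else [::].

Definition chain_step (w : bool) : rel nat := fun a b => a \in pred_range w b.

Lemma path_ltnE s : path ltn 0 s = path (chain_step false) 0 s.
Proof.
apply: eq_path => a b; rewrite /chain_step mem_pred_range addn0.
by case: b => [|b].
Qed.

(** Starting at [0] instead of [1] is harmless: [pred_range] is empty at [0], so every entry is
    positive anyway. *)
Lemma path_leqE s : path leq 1 s = path (chain_step true) 0 s.
Proof.
case: s => [//|b s] /=; rewrite /chain_step mem_pred_range addn1 /= andbT.
case: b => [//|b] /=; elim: s b => [//|c s IH] b /=.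
rewrite mem_pred_range addn1 ltnS; case: c => [//|c] /=.
by rewrite IH.
Qed.

Lemma mem_chains w r m s : (s \in chains w r m) =
  [&& size s == r, path (chain_step w) 0%N s & last 0%N s == m].
Proof.
elim: r m s => [|r IH] m s /=.
  by case: eqP => [->|/eqP mn0]; case: s => [|x s] //=; rewrite eq_sym; case: eqP mn0.
apply/allpairsPdep/idP => [[a [s' [am s's ->]]]|].
  move: s's; rewrite IH => /and3P[/eqP ss ps /eqP la].
  by rewrite size_rcons ss eqxx rcons_path ps last_rcons eqxx andbT /= la.
case/lastP: s => [//|s x].
rewrite size_rcons eqSS rcons_path last_rcons => /and3P[ss /andP[ps lx] /eqP <-].
by exists (last 0%N s), s; split => //; rewrite IH ss ps eqxx.
Qed.

Lemma chains_uniq w r m : uniq (chains w r m).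
Proof.
elim: r m => [|r IH] m /=; first by case: ifP.
apply: allpairs_uniq_dep => [|a _|[a s] [a' s']]; [exact: pred_range_uniq|exact: IH|].
move=> /allpairsPdep[a1 [s1 [_ h1 [-> ->]]]] /allpairsPdep[a2 [s2 [_ h2 [-> ->]]]] /=.
move=> /rcons_inj[e]; move: h1 h2; rewrite !mem_chains e.
by move=> /and3P[_ _ /eqP <-] /and3P[_ _ /eqP <-].
Qed.

Section ChainSums.
Variable R : realType.
Implicit Types (P Q : argindex R) (w : bool).

Lemma chain_prod_rcons P c s m : size s = size P ->
  chain_prod (rcons P c) (rcons s m) =
  chain_prod P s * (c.1 ^+ (m - last 0%N s) / m%:R ^+ c.2).
Proof.
move=> ss; rewrite /chain_prod size_rcons big_ord_recr /=; congr (_ * _); last first.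
  rewrite !nth_rcons ltnn eqxx ss ltnn eqxx -rcons_cons nth_rcons /= ss ltnSn.
  by rewrite -ss (last_nth 0%N).
apply: eq_bigr => i _ /=; rewrite -rcons_cons !nth_rcons /= ss ltn_ord.
by rewrite (leqW (ltn_ord i)).
Qed.

Definition csum w P m : R[i] := \sum_(s <- chains w (size P) m) chain_prod P s.

Lemma csum_nil w m : csum w [::] m = (m == 0%N)%:R.
Proof.
rewrite /csum /=; case: ifP => _; last by rewrite big_nil.
by rewrite big_seq1 /chain_prod big_ord0.
Qed.

Lemma csum_rcons w P c m : csum w (rcons P c) m =
  (\sum_(a <- pred_range w m) csum w P a * c.1 ^+ (m - a)) / m%:R ^+ c.2.
Proof.
rewrite /csum size_rcons /= big_allpairs_dep /= mulr_suml.
apply: eq_bigr => a _; rewrite !mulr_suml big_seq [RHS]big_seq.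
apply: eq_bigr => s; rewrite mem_chains => /and3P[/eqP ss _ /eqP la].
by rewrite chain_prod_rcons // la mulrA.
Qed.

Lemma csum0 w P : csum w P 0 = (P == [::])%:R.
Proof.
by case/lastP: P => [|P c]; rewrite ?csum_nil // csum_rcons big_nil mul0r; case: P.
Qed.

Lemma idx_up_rcons P c : idx_up (rcons P c) = rcons P (c.1, c.2.+1).
Proof.
case: c => z k; elim: P => [//|[z' k'] [//|c P] IH].
exact: (congr1 (cons (z', k')) IH).
Qed.

Lemma csum_up w P m : P != [::] -> csum w (idx_up P) m = csum w P m / m%:R.
Proof.
case/lastP: P => [//|P c] _; rewrite idx_up_rcons !csum_rcons /=.
by rewrite exprSr invfM mulrA.
Qed.

(** Multiplied by [m], the arrowed sum is the convolution of [csum false P a] with [v ^+ (m - a)]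
    over [a < m]. Passing to [m.+1] multiplies the old terms by [v] and adds the term [a = m], which
    also carries [v]. *)
Lemma csum_arrow_succ P v m : v != 0 ->
  m.+1%:R * csum false (idx_arrow v P) m.+1 =
  v * (csum false P m + m%:R * csum false (idx_arrow v P) m).
Proof.
move=> v0; rewrite /idx_arrow (negPf v0).
have cE k : k%:R * csum false (rcons P (v, 1%N)) k =
    \sum_(a <- iota 0 k) csum false P a * v ^+ (k - a).
  case: k => [|k]; first by rewrite mul0r big_nil.
  by rewrite csum_rcons /= expr1 mulrC divfK ?pnatr_eq0 // /pred_range addn0.
rewrite !cE -[in LHS](addn1 m) iotaD big_cat big_seq1 /= add0n addn1 subSnn expr1 mulrDr.
rewrite addrC; congr (_ + _); first by rewrite mulrC.
rewrite mulr_sumr big_seq [RHS]big_seq.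
apply: eq_bigr => a; rewrite mem_iota /= add0n => am.
by rewrite subSn ?(ltnW am) // exprS mulrCA.
Qed.

Definition arrow_tail t Q m : R[i] := m%:R * csum true (idx_arrow t Q) m.

(** The convolution now includes [a = m], so the new term [a = m.+1] comes without [t]; for [t = 0]
    the tail is [csum true Q] itself at positive arguments. At [m = 0] the relation fails for empty
    [Q] and nonzero [t], as [csum true [::] 0 = 1]. *)
Lemma arrow_tail_succ t Q m : (0 < m)%N ->
  arrow_tail t Q m.+1 = t * arrow_tail t Q m + csum true Q m.+1.
Proof.
move=> m0; rewrite /arrow_tail /idx_arrow; case: eqP => [->|/eqP t0].
  rewrite mul0r add0r; case: (altP (Q =P [::])) => [->|Qn].
    by rewrite !csum_nil mulr0.
  by rewrite csum_up // mulrC divfK // pnatr_eq0.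
have cE k : (0 < k)%N -> k%:R * csum true (rcons Q (t, 1%N)) k =
    \sum_(a <- iota 0 k.+1) csum true Q a * t ^+ (k - a).
  case: k => [//|k] _.
  by rewrite csum_rcons /= expr1 mulrC divfK ?pnatr_eq0 // /pred_range addn1.
rewrite !cE // -[m.+2](addn1 m.+1) iotaD big_cat big_seq1 add0n subnn expr0 mulr1.
congr (_ + _); rewrite mulr_sumr big_seq [RHS]big_seq.
apply: eq_bigr => a; rewrite mem_iota add0n ltnS => /andP[_ am].
by rewrite subSn // exprS mulrCA.
Qed.

(** Taking moduli of the arguments turns a term into its absolute value, so absolute sums are sums
    of the same kind and obey the same recurrences. *)
Definition absidx P : argindex R := [seq (`|c.1|, c.2) | c <- P].

Lemma absidx_rcons P c : absidx (rcons P c) = rcons (absidx P) (`|c.1|, c.2).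
Proof. exact: map_rcons. Qed.

Lemma absidx_up P : absidx (idx_up P) = idx_up (absidx P).
Proof.
case/lastP: P => [//|P c].
by rewrite idx_up_rcons !absidx_rcons idx_up_rcons.
Qed.

Lemma absidx_arrow v P : absidx (idx_arrow v P) = idx_arrow `|v| (absidx P).
Proof.
rewrite /idx_arrow normr_eq0; case: ifP => _; first exact: absidx_up.
exact: absidx_rcons.
Qed.

Lemma norm_chain_prod P s : `|chain_prod P s| = chain_prod (absidx P) s.
Proof.
rewrite /chain_prod normr_prod size_map; apply: eq_bigr => i _.
by rewrite (nth_map (0, 0%N)) //= normrM normfV !normrX normr_nat.
Qed.

Lemma norm_csum_le w P m : `|csum w P m| <= csum w (absidx P) m.
Proof.
rewrite /csum size_map (le_trans (ler_norm_sum _ _ _)) //.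
by apply: ler_sum => s _; rewrite norm_chain_prod.
Qed.

Lemma csum_abs_ge0 w P m : 0 <= csum w (absidx P) m.
Proof. exact: le_trans (norm_csum_le w P m). Qed.

End ChainSums.

(** * Truncated series as sums over compositions *)

Lemma coef_prod_eq (F : comNzRingType) (I : Type) (r : seq I) (p q : I -> {poly F}) M :
  (forall i k, (k <= M)%N -> (p i)`_k = (q i)`_k) ->
  (\prod_(i <- r) p i)`_M = (\prod_(i <- r) q i)`_M.
Proof.
move=> pq.
suff : forall k, (k <= M)%N -> (\prod_(i <- r) p i)`_k = (\prod_(i <- r) q i)`_k by apply.
elim: r => [|i r IH] k kM; first by rewrite !big_nil.
rewrite !big_cons !coefM; apply: eq_bigr => j _.
by rewrite pq ?IH // (leq_trans _ kM) ?leq_subr // -ltnS.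
Qed.

Section CompSum.
Variables (F : comNzRingType) (n : nat).
Implicit Types (f g : 'I_n -> nat -> F).

(** The sum of [\prod_j f j (m j)] over all compositions of total [M], encoded through generating
    polynomials so that shifting or rescaling one slot acts on a single factor. *)
Definition comp_sum f M : F := (\prod_j \poly_(m < M.+1) f j m)`_M.

Lemma comp_sum_poly f B M : (M < B)%N ->
  comp_sum f M = (\prod_j \poly_(m < B) f j m)`_M.
Proof.
move=> MB; apply: coef_prod_eq => j k kM; rewrite !coef_poly ltnS kM.
by rewrite (leq_ltn_trans kM).
Qed.

Lemma comp_sumE f B M : (M < B)%N ->
  comp_sum f M =
  \sum_(m : {ffun 'I_n -> 'I_B} | (\sum_j m j)%N == M) \prod_j f j (m j).
Proof.
move=> MB; rewrite (comp_sum_poly _ MB).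
under eq_bigr do rewrite poly_def.
rewrite bigA_distr_bigA /= coef_sum [RHS]big_mkcond; apply: eq_bigr => m _.
under eq_bigr do rewrite -mul_polyC.
rewrite big_split /= -rmorph_prod /= -expr_sum coefCM coefXn eq_sym.
by case: eqP => _; rewrite ?mulr1 ?mulr0.
Qed.

End CompSum.

Lemma big_seq_sub_val (T : choiceType) (F : nmodType) (K s : seq T) (f : T -> F) :
  uniq s -> {subset s <= K} ->
  \sum_(x <- s) f x = \sum_(x : seq_sub K | val x \in s) f (val x).
Proof.
move=> us sK; rewrite -(big_map val (mem s) f) -[RHS]big_filter; apply: perm_big.
apply: uniq_perm => //.
  by rewrite filter_uniq // map_inj_uniq ?index_enum_uniq //; exact: val_inj.
move=> x; rewrite mem_filter /=; apply/idP/andP => [xs|[]//]; split => //.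
by apply/mapP; exists (SeqSub (sK _ xs)); rewrite ?mem_index_enum.
Qed.

Lemma chain_families (F : comNzRingType) (n : nat) (r : 'I_n -> nat) (M : nat) :
  exists l : seq {ffun 'I_n -> seq nat},
  [/\ uniq l,
      forall f, (f \in l) = [forall j, (size (f j) == r j) && path ltn 0 (f j)]%N
                            && ((\sum_j last 0 (f j))%N == M)
    & forall G : 'I_n -> seq nat -> F, \sum_(f <- l) \prod_j G j (f j) =
        comp_sum (fun j m => \sum_(s <- chains false (r j) m) G j s) M].
Proof.
(* Every chain of a family of total [M] ends at most at [M], so all of them come from the finite
   list [K], and families become finite functions into [seq_sub K]. *)
pose K := [seq s | x <- [seq (j, m) | j <- enum 'I_n, m <- iota 0 M.+1],
             s <- chains false (r x.1) x.2].
have memK j m s : (m <= M)%N -> s \in chains false (r j) m -> s \in K.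
  move=> mM sc; apply/allpairsPdep; exists (j, m), s; split=> //.
  by apply/allpairsP; exists (j, m); rewrite mem_enum mem_iota.
pose ok (f : {ffun 'I_n -> seq nat}) :=
  [forall j, (size (f j) == r j) && path ltn 0 (f j)]%N
    && ((\sum_j last 0 (f j))%N == M).
pose emb (g : {ffun 'I_n -> seq_sub K}) : {ffun 'I_n -> seq nat} := [ffun j => val (g j)].
have embI : injective emb.
  by move=> g h /ffunP e; apply/ffunP => j; have := e j; rewrite !ffunE => /val_inj.
have lastM f j : ok f -> (last 0 (f j) <= M)%N.
  by case/andP => _ /eqP <-; rewrite (bigD1 j) //= leq_addr.
exists [seq emb g | g <- enum [pred g | ok (emb g)]]; split.
- by rewrite map_inj_uniq // enum_uniq.
- move=> f; rewrite -/(ok f); apply/mapP/idP => [[g]|okf].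
    by rewrite mem_enum inE => okg ->.
  have fK j : f j \in K.
    apply: (memK j _ _ (lastM _ j okf)); rewrite mem_chains -path_ltnE eqxx andbT.
    by case/andP: okf => /forallP.
  have ef : f = emb [ffun j => SeqSub (fK j)] by apply/ffunP => j; rewrite !ffunE.
  by exists [ffun j => SeqSub (fK j)] => //; rewrite mem_enum inE -ef.
move=> G; rewrite big_map big_enum /= (eq_bigl (fun g => ok (emb g))) //.
rewrite (comp_sumE _ (ltnSn M)).
pose p (g : {ffun 'I_n -> seq_sub K}) : {ffun 'I_n -> 'I_M.+1} :=
  [ffun j => inord (last 0%N (val (g j)))].
(* Families are grouped by their end points; each group is a full product of sets of chains, to
   which distributivity applies. *)
rewrite (partition_big p (fun m => (\sum_j m j)%N == M)) /=; last first.
  move=> g okg; case/andP: (okg) => _ /eqP sM; apply/eqP; apply: etrans sM.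
  apply: eq_bigr => j _; rewrite /p !ffunE inordK // ltnS.
  by have := lastM _ j okg; rewrite ffunE.
apply: eq_bigr => m /eqP mM.
transitivity (\prod_j \sum_(x : seq_sub K | val x \in chains false (r j) (m j)) G j (val x)).
  rewrite bigA_distr_big_dep; apply: eq_big => [g|g _]; last first.
    by apply: eq_bigr => j _; rewrite ffunE.
  apply/andP/familyP => [[okg /eqP <-] j|fg].
    suff : val (g j) \in chains false (r j) (p g j) by [].
    rewrite mem_chains -path_ltnE ffunE inordK; last first.
      by rewrite ltnS; have := lastM _ j okg; rewrite ffunE.
    rewrite eqxx andbT; have /andP[/forallP/(_ j)] := okg.
    by rewrite ffunE.
  have fg' j : [/\ size (val (g j)) == r j, path ltn 0 (val (g j)) &
                   last 0%N (val (g j)) = m j].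
    have : val (g j) \in chains false (r j) (m j) := fg j.
    by rewrite mem_chains -path_ltnE => /and3P[? ? /eqP].
  split; last first.
    apply/eqP/ffunP => j; apply/val_inj; rewrite ffunE; case: (fg' j) => _ _ ->.
    by rewrite inord_val.
  apply/andP; split; first by apply/forallP => j; rewrite ffunE; case: (fg' j) => -> ->.
  by apply/eqP; apply: etrans mM; apply: eq_bigr => j _; rewrite ffunE; case: (fg' j).
apply: eq_bigr => j _; rewrite -big_seq_sub_val ?chains_uniq //.
by move=> s; apply: memK; rewrite -ltnS.
Qed.

Section Boxes.
Variables (R : realType) (n : nat).
Implicit Types (P : 'I_n -> argindex R) (Q : argindex R).

(** The series restricted to [q_s <= N] and grouped by the total [M]; the numerators of [C] are
    distributed over the slots. *)
Definition Zsum P Q N : R[i] := \sum_(M < N.+1)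
  comp_sum (fun j m => m`!%:R * csum false (P j) m) M / M`!%:R
    * (M%:R * csum true Q M).

(** The boxes depend only on the depths, so the same boxes serve an index and its [absidx]. *)
Lemma Zbox (r : 'I_n -> nat) (q : nat) : exists b : nat -> seq (Zidx n),
  [/\ forall N, uniq (b N),
      forall P Q, (forall j, size (P j) = r j) -> size Q = q ->
        forall N c, (c \in b N) = Zdom P Q c && (last 0 c.2 <= N)%N
    & forall P Q, (forall j, size (P j) = r j) -> size Q = q ->
        forall N, \sum_(c <- b N) Zterm P Q c = Zsum P Q N].
Proof.
have [l hl] := choice (fun M => chain_families R[i] r M).
exists (fun N => [seq (x.2, s) | x <- [seq (M, f) | M <- iota 0 N.+1, f <- l M],
                                 s <- chains true q x.1]).
have lE N M f : ((M, f) \in [seq (M, f) | M <- iota 0 N.+1, f <- l M]) =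
    (M <= N)%N && (f \in l M).
  apply/allpairsPdep/andP => [[M' [f' [+ f'l [-> ->]]]]|[MN fl]].
    by rewrite mem_iota.
  by exists M, f; rewrite mem_iota.
split.
- move=> N; apply: allpairs_uniq_dep => [|[M f] _|].
  + apply: allpairs_uniq_dep => [|M _|[M f] [M' f'] _ _ [-> ->]//]; first exact: iota_uniq.
    by case: (hl M).
  + exact: chains_uniq.
  move=> [[M f] s] [[M' f'] s'].
  move=> /allpairsPdep[[M1 f1] [s1 [_ h1 [-> -> ->]]]].
  move=> /allpairsPdep[[M2 f2] [s2 [_ h2 [-> -> ->]]]] /= [-> e].
  move: h1 h2; rewrite !mem_chains e => /and3P[_ _ /eqP /= e1] /and3P[_ _ /eqP /= e2].
  by rewrite -e1 -e2.
- move=> P Q sP sQ N [f s]; rewrite /Zdom /=.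
  apply/allpairsPdep/idP => [[[M f'] [s' [+ + [-> ->]]]]|].
    rewrite lE mem_chains /= -path_leqE sQ => /andP[MN].
    case: (hl M) => _ -> _ /andP[/forallP hf /eqP lM] /and3P[-> -> /eqP lM'].
    rewrite lM lM' eqxx MN !andbT; apply/forallP => j; rewrite sP; exact: hf.
  move=> /andP[/and4P[/forallP hf ss ps /eqP lM] lN].
  exists (last 0%N s, f), s; split=> //; last by rewrite mem_chains -path_leqE -sQ ss ps /=.
  rewrite lE lN /=; case: (hl (last 0%N s)) => _ -> _.
  by rewrite lM eqxx andbT; apply/forallP => j; rewrite -sP.
move=> P Q sP sQ N; rewrite big_allpairs_dep big_allpairs_dep.
rewrite -[iota 0 N.+1]/(index_iota 0 N.+1) big_mkord; apply: eq_bigr => M _.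
case: (hl M) => _ hf hG.
transitivity (\sum_(f <- l M) (\prod_j ((last 0%N (f j))`!%:R * chain_prod (P j) (f j))) /
   M`!%:R * (M%:R * csum true Q M)).
  rewrite big_seq [RHS]big_seq; apply: eq_bigr => f.
  rewrite hf => /andP[_ /eqP fM]; rewrite /csum sQ !mulr_sumr big_seq [RHS]big_seq.
  apply: eq_bigr => s; rewrite mem_chains => /and3P[_ _ /eqP sM].
  rewrite /Zterm /Cfact /= sM fM big_split /= natr_prod; congr (_ * _).
  by rewrite mulrAC.
rewrite -!mulr_suml (hG (fun j s => (last 0%N s)`!%:R * chain_prod (P j) s)).
congr (_ / _ * _); apply: coef_prod_eq => j k _; rewrite !coef_poly; case: ifP => // _.
rewrite /csum sP mulr_sumr big_seq [RHS]big_seq; apply: eq_bigr => s.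
by rewrite mem_chains => /and3P[_ _ /eqP ->].
Qed.
End Boxes.

(** * Convergence of the truncations to the series *)

Section ZnLimit.
Variables (R : realType) (n : nat).
Implicit Types (P : 'I_n -> argindex R) (Q : argindex R).

Lemma norm_Zterm P Q c :
  `|Zterm P Q c| = Zterm (fun j => absidx (P j)) (absidx Q) c.
Proof.
rewrite /Zterm /Cfact !normrM normfV !normr_nat norm_chain_prod normr_prod.
by congr (_ * _ * _); apply: eq_bigr => j _; rewrite norm_chain_prod.
Qed.

Lemma Zn_cvg P Q (B : R) :
  (forall N, Zsum (fun j => absidx (P j)) (absidx Q) N <= B%:C%C) ->
  Zn_abs_cvg P Q /\ ((Zsum P Q : nat -> R[i]^o) @ \oo --> (Zn P Q : R[i]^o))%classic.
Proof.
move=> hB; have [b [bu bE bS]] := @Zbox R n (fun j => size (P j)) (size Q).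
have bB N : \sum_(c <- b N) `|Zterm P Q c| <= B%:C%C.
  rewrite (eq_bigr _ (fun c _ => norm_Zterm P Q c)) bS //; last by rewrite size_map.
  by move=> j; rewrite size_map.
have bD := bE P Q (fun=> erefl) erefl.
split; first exact: (summable_box bu bD bB).
have := cvgn_sum_box bu bD bB.
under eq_fun do rewrite bS //.
(* For empty [Q] the value is [0] by convention; the truncations vanish too, since the empty chain
   ends in [0] and the factor [q_s] is then [0]. *)
rewrite /Zn; case: (Q) => [_|//].
rewrite (_ : Zsum P [::] = cst 0); first exact: cvg_cst.
apply/funext => N; rewrite /Zsum big1 // => M _; rewrite csum_nil.
by case: (M : nat) => [|m]; rewrite ?mul0r ?mulr0.
Qed.

End ZnLimit.

(** * Identities for composition sums and the truncated identity *)

Definition upd (F : Type) n (f : 'I_n -> nat -> F) (i : 'I_n) (x : nat -> F) :=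
  fun j m => if j == i then x m else f j m.

Section CompSumIdentities.
Variables (F : comNzRingType) (n : nat).
Implicit Types (f : 'I_n -> nat -> F) (x y : nat -> F) (i : 'I_n).

Lemma eq_comp_sum f g M : (forall j m, f j m = g j m) -> comp_sum f M = comp_sum g M.
Proof. by move=> fg; apply: coef_prod_eq => j k _; rewrite !coef_poly fg. Qed.

Lemma comp_sum_updE f i x M B : (M < B)%N -> comp_sum (upd f i x) M =
  (\poly_(m < B) x m * \prod_(j | j != i) \poly_(m < B) f j m)`_M.
Proof.
move=> MB; rewrite (comp_sum_poly _ MB) (bigD1 i) //= /upd eqxx.
congr (polyseq (_ * _))`_M; apply: eq_bigr => j ji.
by apply/polyP => k; rewrite !coef_poly (negPf ji).
Qed.

Lemma comp_sum_upd_lin f i a x y M :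
  comp_sum (upd f i (fun m => a * x m - y m)) M =
  a * comp_sum (upd f i x) M - comp_sum (upd f i y) M.
Proof.
rewrite !(comp_sum_updE _ _ _ (ltnSn M)) -coefZ -coefB scalerAl -mulrBl.
congr (polyseq (_ * _))`_M; apply/polyP => k; rewrite coefB coefZ !coef_poly.
by case: ifP => _; rewrite ?mulr0 ?subr0.
Qed.

(** As [f i 0 = 0], shifting slot [i] divides its polynomial by [X], up to the truncation. *)
Lemma comp_sum_shift f i M : f i 0%N = 0 ->
  comp_sum (upd f i (fun m => f i m.+1)) M = comp_sum f M.+1.
Proof.
move=> f0; rewrite -[RHS](@eq_comp_sum (upd f i (f i))); last first.
  by move=> j m; rewrite /upd; case: eqP => [->|].
have [MB M1B] : (M < M.+3)%N /\ (M.+1 < M.+3)%N by split; [exact: leqW (leqnSn M.+1)|exact: leqnSn].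
rewrite (comp_sum_updE _ _ _ MB) (comp_sum_updE _ _ _ M1B).
set p := \prod_(_ | _) _.
have -> : (\poly_(m < M.+3) f i m.+1 * p)`_M = ('X * \poly_(m < M.+3) f i m.+1 * p)`_M.+1.
  by rewrite -mulrA coefXM.
(* The overshoot sits in degree [M.+3], beyond the coefficient [M.+1] that is read off. *)
have -> : 'X * \poly_(m < M.+3) f i m.+1 = \poly_(m < M.+3) f i m + f i M.+3 *: 'X^(M.+3).
  apply/polyP => -[|k]; rewrite coefXM coefD coefZ coefXn !coef_poly //=.
    by rewrite f0 mulr0 addr0.
  case: (ltngtP k.+1 M.+3) => [km|km|e]; rewrite ?mulr0 ?mulr1 ?addr0 ?add0r //.
  by rewrite e.
by rewrite mulrDl coefD -scalerAl coefZ coefXnM M1B mulr0 addr0.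
Qed.

Lemma comp_sum_deriv f M :
  M%:R * comp_sum f M = \sum_i comp_sum (upd f i (fun m => m%:R * f i m)) M.
Proof.
under eq_bigr do rewrite (comp_sumE _ (ltnSn M)).
rewrite (comp_sumE _ (ltnSn M)) exchange_big mulr_sumr /=.
apply: eq_bigr => m /eqP mM; rewrite -[in M%:R]mM natr_sum mulr_suml.
apply: eq_bigr => i _; rewrite [in RHS](bigD1 i) //= (bigD1 i) //= /upd eqxx mulrA.
by congr (_ * _); apply: eq_bigr => j /negPf ->.
Qed.

(** Two or more parts of total [1] include a zero part. This starts the telescoping. *)
Lemma comp_sum1_eq0 f : (1 < n)%N -> (forall j, f j 0%N = 0) -> comp_sum f 1 = 0.
Proof.
move=> n1 f0; rewrite (comp_sumE _ (ltnSn 1)) big1 // => m /eqP m1.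
have [j mj0] : exists j, m j = 0%N :> nat.
  suff /existsP[j /eqP] : [exists j, (m j == 0 :> nat)%N] by exists j.
  apply: contraTT n1 => /existsPn m_gt0.
  rewrite -leqNgt -m1 -[n in (n <= _)%N]card_ord -sum1_card.
  by apply: leq_sum => j _; rewrite lt0n.
by rewrite (bigD1 j) //= mj0 f0 mul0r.
Qed.

End CompSumIdentities.

(** The boundary term at [N] combines with the next summand through [G m.+1 - t * G m = h m.+1].
    This recurrence is available only from [m = 1] on, so the induction starts at [N = 1], where
    [psi 1 = 0] removes the contributions of [M = 0] and of [h 1]. *)
Lemma telescope_tail (F : numFieldType) (t : F) (psi G h : nat -> F) N :
  psi 1%N = 0 -> (0 < N)%N ->
  (forall m, (0 < m)%N -> G m.+1 = t * G m + h m.+1) ->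
  \sum_(M < N.+1) (t * psi M.+1 - M%:R * psi M) / M`!%:R * G M =
  t * psi N.+1 / N`!%:R * G N - \sum_(M < N.+1) psi M / M`!%:R * (M%:R * h M).
Proof.
move=> psi1 + Gh; elim: N => [//|[_ _|N IH _]].
  by rewrite !big_ord_recr !big_ord0 /= psi1 !(oppr0, mulr0n, mul0r, mulr0, add0r, subr0, addr0).
have N2 : N.+2%:R != 0 :> F by rewrite pnatr_eq0.
have Nf : N.+1`!%:R != 0 :> F by rewrite pnatr_eq0 -lt0n fact_gt0.
have fE : N.+2`!%:R = N.+2%:R * N.+1`!%:R :> F by rewrite factS natrM.
rewrite big_ord_recr [in RHS]big_ord_recr /= IH // (Gh N.+1) // fE.
move: (N.+1`!%:R) Nf (N.+2%:R) N2 => a a0 b b0.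
move: (\sum_(_ < _) _) => S; field.
by rewrite a0 b0.
Qed.

Section TruncatedIdentity.
Variables (R : realType) (n d : nat).
Variables (P : 'I_n -> argindex R) (Q : argindex R) (v : 'I_n -> R[i]) (t : R[i]).
Hypothesis n1 : (1 < n)%N.
Hypothesis hPne : forall i : 'I_n, (d <= i)%N -> P i <> [::].
Hypothesis hv : forall i : 'I_n, (i < d)%N -> v i != 0.
Hypothesis hvt : \sum_(i < n | (i < d)%N) (v i)^-1 = t.

Let full := fun j : 'I_n =>
  if (j < d)%N then idx_arrow (v j) (P j) else idx_up (P j).
Let slot := fun i j : 'I_n => if j == i then P j else full j.

(** The numerator [m!] of [C] is absorbed into the chain sum: for [full] this is [psi_j], for a bare
    slot [m! f_j]. *)
Definition fact_csum (P : 'I_n -> argindex R) j m : R[i] :=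
  m`!%:R * csum false (P j) m.

Lemma fact_csum_full0 j : fact_csum full j 0 = 0.
Proof.
rewrite /fact_csum csum0 /full; case: ifP => [jd|/negbT].
  by rewrite /idx_arrow (negPf (hv jd)) -size_eq0 size_rcons mulr0.
rewrite -leqNgt => /hPne; case/lastP: (P j) => [//|p c _].
by rewrite idx_up_rcons -size_eq0 size_rcons mulr0.
Qed.

(** The relation [m! f_i(m) = psi_i(m+1) / v_i - m psi_i(m)] is applied inside slot [i]; the shift
    turns its first part into a sum of total [M.+1] that no longer depends on [i]. *)
Lemma comp_sum_slot_arrow (i : 'I_n) M : (i < d)%N ->
  comp_sum (fact_csum (slot i)) M =
  (v i)^-1 * comp_sum (fact_csum full) M.+1
  - comp_sum (upd (fact_csum full) i (fun m => m%:R * fact_csum full i m)) M.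
Proof.
move=> ltid; rewrite -(comp_sum_shift _ (fact_csum_full0 i)) -comp_sum_upd_lin.
apply: eq_comp_sum => j m; rewrite /upd /slot /fact_csum; case: eqP => [->|//].
rewrite /full ltid factS natrM -mulrA (mulrCA m.+1%:R) csum_arrow_succ ?hv //.
rewrite mulrCA mulrA mulrA mulrAC; field.
exact: hv.
Qed.

Lemma comp_sum_slot_up (i : 'I_n) M : (d <= i)%N ->
  comp_sum (fact_csum (slot i)) M =
  comp_sum (upd (fact_csum full) i (fun m => m%:R * fact_csum full i m)) M.
Proof.
move=> di; apply: eq_comp_sum => j m; rewrite /upd /slot /fact_csum.
case: eqP => [->|//]; rewrite /full ltnNge di /=.
have Pi : P i != [::] by apply/eqP/hPne.
(* Both sides vanish at [m = 0] because [P i] is non-empty; elsewhere [m] cancels the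
   denominator. *)
rewrite csum_up // mulrCA; congr (_ * _); case: m => [|m].
  by rewrite csum0 (negPf Pi) mul0r.
by rewrite mulrC divfK // pnatr_eq0.
Qed.

Lemma truncated_identity N : (0 < N)%N ->
  \sum_(i < n | (i < d)%N) Zsum (slot i) (idx_arrow t Q) N
  - \sum_(i < n | (d <= i)%N) Zsum (slot i) (idx_arrow t Q) N =
  t * comp_sum (fact_csum full) N.+1 / N`!%:R * arrow_tail t Q N - Zsum full Q N.
Proof.
move=> N0; rewrite {2}/Zsum.
rewrite -(@telescope_tail _ t (comp_sum (fact_csum full)) (arrow_tail t Q) (csum true Q)) //;
  last 2 first.
- exact: comp_sum1_eq0 fact_csum_full0.
- by move=> m; exact: arrow_tail_succ.
rewrite /Zsum exchange_big [X in _ - X]exchange_big /= -sumrB; apply: eq_bigr => M _.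
rewrite -!mulr_suml -mulrBl -mulrBl; congr (_ / _ * _).
(* The inverses of the [v_i] add up to [t]. The terms with [m psi_i(m)] from both ranges of [i] all
   carry a minus sign and add up to [M] times the composition sum, since [M] is the sum of the
   parts. *)
rewrite comp_sum_deriv -hvt mulr_suml [X in _ = _ - X](bigID (fun i : 'I_n => (i < d)%N)) /=.
rewrite opprD addrA -sumrB; congr (_ - _).
  by apply: eq_bigr => i id; exact: comp_sum_slot_arrow.
apply: eq_big => [i|i di]; first by rewrite -leqNgt.
exact: comp_sum_slot_up.
Qed.

End TruncatedIdentity.

(** * Estimates *)

Section Lharm.
Variable F : numFieldType.
Implicit Types (m r : nat).

(** The leading [1] makes every power at least [1], also at [m = 0]. The field is general because
    chain sums live in [R[i]] and the growth estimates in [R]. *)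
Definition Lharm m : F := 1 + \sum_(k < m) k.+1%:R^-1.

Lemma LharmS m : Lharm m.+1 = Lharm m + m.+1%:R^-1.
Proof. by rewrite /Lharm big_ord_recr addrA. Qed.

Lemma Lharm_ge1 m : 1 <= Lharm m.
Proof. by rewrite lerDl sumr_ge0 // => k _; rewrite invr_ge0 ler0n. Qed.

Lemma Lharm_ge0 m : 0 <= Lharm m.
Proof. exact: le_trans (Lharm_ge1 m). Qed.

Lemma Lharm_le m p : (m <= p)%N -> Lharm m <= Lharm p.
Proof.
move=> mp; rewrite -(subnKC mp); elim: (p - m)%N => [|k IH]; first by rewrite addn0.
by rewrite addnS LharmS ler_wpDr // invr_ge0 ler0n.
Qed.

Lemma LharmX_ge1 m r : 1 <= Lharm m ^+ r.
Proof. exact: exprn_ege1 (Lharm_ge1 m). Qed.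

Lemma LharmX_ge0 m r : 0 <= Lharm m ^+ r.
Proof. exact: exprn_ge0 (Lharm_ge0 m). Qed.

Lemma LharmX_le m p r s : (m <= p)%N -> (r <= s)%N -> Lharm m ^+ r <= Lharm p ^+ s.
Proof.
move=> mp rs; apply: (@le_trans _ _ (Lharm p ^+ r)).
  by rewrite lerXn2r ?nnegrE ?Lharm_ge0 ?Lharm_le.
exact: ler_weXn2l (Lharm_ge1 p) _ _ rs.
Qed.

Lemma sum_Lharm_le (x : nat -> F) r m : x 0%N <= 1 ->
  (forall a, (0 < a)%N -> x a <= Lharm a ^+ r / a%:R) ->
  \sum_(a < m.+1) x a <= Lharm m ^+ r.+1.
Proof.
move=> x0 xa; rewrite big_ord_recl exprSr mulrDr mulr1 lerD //.
  exact: le_trans (LharmX_ge1 m r).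
rewrite mulr_sumr; apply: ler_sum => a _; rewrite lift0 (le_trans (xa _ _)) //.
by rewrite ler_wpM2r ?invr_ge0 ?ler0n // LharmX_le // ltn_ord.
Qed.

End Lharm.

Section CsumBounds.
Variable R : realType.
Implicit Types (P Q : argindex R) (w : bool).

Lemma is_argindex_rcons P c : is_argindex (rcons P c) =
  [&& `|c.1| <= 1, (0 < c.2)%N & is_argindex P].
Proof. by rewrite /is_argindex all_rcons andbA. Qed.

(** Induction on the columns: [|z| <= 1] and [k >= 1] reduce each column to [z = 1], [k = 1], where
    summing over the predecessors, strict or weak, costs one factor [Lharm]. *)
Lemma csum_abs_le w P m : is_argindex P -> (0 < m)%N ->
  csum w (absidx P) m <= Lharm R[i] m ^+ size P / m%:R.
Proof.
elim/last_ind: P m => [|P c IH] m.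
  by case: m => [//|m] _ _; rewrite csum_nil divr_ge0 ?LharmX_ge0.
rewrite is_argindex_rcons => /and3P[c1 c2 hP] m0.
rewrite absidx_rcons csum_rcons size_rcons /=.
have mc : m%:R ^- c.2 <= m%:R^-1 :> R[i].
  rewrite lef_pV2 ?posrE ?exprn_gt0 ?ltr0n //.
  by rewrite -[leLHS]expr1 ler_weXn2l // ler1n.
have s0 : 0 <= \sum_(a <- pred_range w m) csum w (absidx P) a * `|c.1| ^+ (m - a).
  by apply: sumr_ge0 => a _; rewrite mulr_ge0 ?csum_abs_ge0 ?exprn_ge0.
apply: (@le_trans _ _ ((\sum_(a <- pred_range w m) csum w (absidx P) a * `|c.1| ^+ (m - a)) / m%:R)).
  exact: ler_wpM2l.
rewrite ler_wpM2r ?invr_ge0 ?ler0n //.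
apply: (@le_trans _ _ (\sum_(a <- pred_range w m) csum w (absidx P) a)).
  apply: ler_sum => a _; rewrite -[leRHS]mulr1 ler_wpM2l ?csum_abs_ge0 //.
  exact: exprn_ile1.
apply: (@le_trans _ _ (\sum_(a <- iota 0 m.+1) csum w (absidx P) a)).
  apply: ler_sum_sub_seq; rewrite ?pred_range_uniq ?iota_uniq //.
    move=> a; rewrite mem_pred_range mem_iota add0n => /andP[_ am] /=.
    by rewrite (leq_trans am) // -addn1 leq_add2l; case: (w).
  by move=> a _; exact: csum_abs_ge0.
rewrite -[iota 0 m.+1]/(index_iota 0 m.+1) big_mkord.
apply: sum_Lharm_le => [|a a0]; last exact: IH.
by rewrite csum0; case: (_ == _).
Qed.

Lemma is_argindex_up P : is_argindex P -> is_argindex (idx_up P).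
Proof.
case/lastP: P => [//|P c]; rewrite idx_up_rcons !is_argindex_rcons /=.
by move=> /and3P[-> _ ->].
Qed.

Lemma is_argindex_arrow v P : `|v| <= 1 -> is_argindex P -> is_argindex (idx_arrow v P).
Proof.
move=> v1 hP; rewrite /idx_arrow; case: ifP => _; first exact: is_argindex_up.
by rewrite is_argindex_rcons v1.
Qed.

End CsumBounds.

(* [(m-1)!] and [(m-2)!], extended by [0]. *)
Definition pfact (m : nat) : nat := if m is k.+1 then k`! else 0.
Definition ppfact (m : nat) : nat := if m is k.+2 then k`! else 0.

Lemma ppfact_le m : (ppfact m <= pfact m)%N.
Proof. by case: m => [|[|m]] //=; rewrite factS leq_pmull. Qed.

Lemma mul_fact_le a b : (a.+1`! * b.+1`! <= (a + b).+1`!)%N.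
Proof.
elim: b => [|b IH]; first by rewrite muln1 addn0.
rewrite [b.+2`!]factS mulnCA addnS [(a + b).+2`!]factS leq_mul //.
by rewrite !ltnS leq_addl.
Qed.

(** The two end terms give [k!] each; the [k - 1] inner ones are at most [(k-1)!] each, so together
    at most another [k!]. *)
Lemma sum_fact_conv_le k : (\sum_(i < k.+1) i`! * (k - i)`! <= 3 * k`!)%N.
Proof.
case: k => [|k]; first by rewrite big_ord_recl big_ord0.
rewrite big_ord_recl big_ord_recr /= subn0 subnn fact0 mul1n muln1.
rewrite [leqRHS](_ : _ = k.+1`! + (k.+1`! + k.+1`!))%N; last by rewrite !mulSn mul0n addn0.
rewrite leq_add2l leq_add2r; apply: (@leq_trans (\sum_(i < k) k`!)%N).
  apply: leq_sum => i _; rewrite /bump /= add1n subSS.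
  by have := mul_fact_le i (k - i.+1); rewrite subnSK // -addSn subnKC.
by rewrite sum_nat_const card_ord factS leq_mul2r leqnSn orbT.
Qed.

Lemma pfact_conv_le M :
  (\sum_(a < M.+1) pfact a * pfact (M - a) <= 3 * ppfact M)%N.
Proof.
case: M => [|[|M]]; [by rewrite big_ord1|by rewrite !big_ord_recl big_ord0|].
rewrite big_ord_recl big_ord_recr /= subnn muln0 addn0 mul0n add0n.
apply: leq_trans (sum_fact_conv_le M); apply: leq_sum => i _.
by rewrite /bump /= add1n subSS subSn ?leq_ord.
Qed.

(** Each convolution costs a factor [3] and improves [pfact] to [ppfact]; the gain is given up
    before the next one and kept only at the last. *)
Lemma coef_pfact_pow (F : numFieldType) k B M : (M < B)%N ->
  ((\poly_(m < B) (pfact m)%:R : {poly F}) ^+ k.+2)`_M <= (3 ^ k.+1 * ppfact M)%:R.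
Proof.
move=> MB; set p := \poly_(_ < _) _.
have step j M' : (M' <= M)%N ->
    (forall M', (M' <= M)%N -> (p ^+ j)`_M' <= (3 ^ j.-1 * pfact M')%:R) ->
    (p * p ^+ j)`_M' <= (3 ^ j.-1.+1 * ppfact M')%:R.
  move=> M'M hj; rewrite coefM expnS -mulnA mulnCA.
  apply: (@le_trans _ _ (3 ^ j.-1 * \sum_(a < M'.+1) pfact a * pfact (M' - a))%N%:R).
    rewrite natrM natr_sum mulr_sumr; apply: ler_sum => a _.
    have aM : (a <= M)%N by rewrite (leq_trans (leq_ord a)).
    rewrite coef_poly (leq_ltn_trans aM MB) natrM mulrCA -natrM ler_wpM2l ?ler0n //.
    by apply: hj; rewrite (leq_trans (leq_subr _ _)).
  by rewrite ler_nat leq_mul2l pfact_conv_le orbT.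
suff main j : forall M', (M' <= M)%N -> (p ^+ j.+1)`_M' <= (3 ^ j * pfact M')%:R.
  by rewrite exprS; apply: step => // M' ?; exact: main.
elim: j => [|j IH] M' M'M.
  by rewrite expr1 coef_poly (leq_ltn_trans M'M MB) mul1n.
rewrite exprS (le_trans (step _ _ M'M IH)) // ler_nat leq_mul2l ppfact_le orbT //.
Qed.

Section LharmGrowth.
Variable R : realType.

Lemma Lharm_complex m : Lharm R[i] m = (Lharm R m)%:C%C.
Proof.
rewrite /Lharm rmorphD rmorph1 rmorph_sum /=; congr (_ + _).
by apply: eq_bigr => k _; rewrite fmorphV /= rmorph_nat.
Qed.

(** A telescoping product: [exp(-x) >= 1 - x] gives [exp(1/(m+2)) <= (m+2)/(m+1)]. *)
Lemma expR_Lharm_le m : expR (Lharm R m.+1) <= expR 2 * m.+1%:R.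
Proof.
elim: m => [|m IH].
  by rewrite /Lharm big_ord1 invr1 mulr1.
rewrite LharmS expRD.
have h : expR (m.+2%:R^-1 : R) <= m.+2%:R / m.+1%:R.
  have m2 : 0 < m.+2%:R :> R by rewrite ltr0n.
  have m1 : 0 < m.+1%:R :> R by rewrite ltr0n.
  rewrite -[expR _]invrK -expRN -[leRHS]invf_div lef_pV2 ?posrE ?expR_gt0 ?divr_gt0 //.
  apply: le_trans (expR_ge1Dx _).
  rewrite ler_pdivrMr // mulrDl mul1r mulNr mulVf ?gt_eqF //.
  by rewrite -[m.+2]addn1 natrD addrK.
apply: le_trans (ler_pM _ _ IH h) _; rewrite ?expR_ge0 //.
by rewrite -mulrA [m.+1%:R * _]mulrC divfK // pnatr_eq0.
Qed.

Lemma LharmX_le_sqrt K : exists2 C : R, 0 <= C &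
  forall m, Lharm R m.+1 ^+ K <= C * Num.sqrt m.+1%:R.
Proof.
(* With [L = Lharm R m.+1], [L^(2K) <= L^(2K+1) <= (2K+1)! exp L <= A (m+1)]; a square root then
   bounds [L^K]. *)
pose A : R := (2 * K).+1`!%:R * expR 2.
have A0 : 0 <= A by rewrite mulr_ge0 ?ler0n ?expR_ge0.
exists (Num.sqrt A) => [|m]; first exact: sqrtr_ge0.
rewrite -sqrtrM // -[leLHS]ger0_norm ?LharmX_ge0 // -sqrtr_sqr ler_wsqrtr //.
rewrite -exprM mulnC (le_trans (LharmX_le _ (leqnn _) (leqnSn _))) //.
rewrite -mulrA; apply: le_trans (ler_wpM2l (ler0n _ _) (expR_Lharm_le m)).
rewrite mulrC -ler_pdivrMr ?ltr0n ?fact_gt0 //.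
apply: le_trans (expR_ge1Dxn (2 * K) (Lharm_ge0 _ _)).
by rewrite ler_wpDl.
Qed.

(** An integral comparison for the sum of [M^(-3/2)], whose subtracted term makes the bound
    inductive; the summand [M = 0] is [0]. *)
Lemma sum_sqrt_le N :
  \sum_(M < N.+2) Num.sqrt (M%:R : R) * M%:R ^- 2 <= 3 - 2 / Num.sqrt N.+1%:R.
Proof.
elim: N => [|N IH].
  rewrite !big_ord_recl big_ord0 /= sqrtr0 mul0r add0r addr0 /bump /= sqrtr1.
  by rewrite expr1n !invr1; lra.
rewrite big_ord_recr /=; apply: le_trans (lerD IH (lexx _)) _.
have a0 : 0 < Num.sqrt N.+1%:R :> R by rewrite sqrtr_gt0 ltr0n.
have b0 : 0 < Num.sqrt N.+2%:R :> R by rewrite sqrtr_gt0 ltr0n.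
have a2 : Num.sqrt N.+1%:R ^+ 2 = N.+1%:R :> R by rewrite sqr_sqrtr // ler0n.
have b2 : Num.sqrt N.+2%:R ^+ 2 = N.+2%:R :> R by rewrite sqr_sqrtr // ler0n.
have ab : Num.sqrt N.+2%:R ^+ 2 = Num.sqrt N.+1%:R ^+ 2 + 1 :> R.
  by rewrite a2 b2 -[N.+2]addn1 natrD.
rewrite -{2}b2; move: (Num.sqrt N.+1%:R) (Num.sqrt N.+2%:R) a0 b0 ab => a b a0 b0 ab.
have ab_le : a <= b by nra.
have -> : b * (b ^+ 2) ^- 2 = a / (a * b ^+ 3) by field; rewrite !gt_eqF.
have -> : 3 - 2 / a + a / (a * b ^+ 3) =
   3 - 2 / b - (2 * b ^+ 2 * (b - a) - a) / (a * b ^+ 3).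
  by field; rewrite !gt_eqF.
rewrite gerDl oppr_le0 divr_ge0 //.
  (* Since [a <= b], this gives [2 b (b - a) >= 1], hence [2 b^2 (b - a) >= b >= a]. *)
  have : (b - a) * (b + a) = 1 by rewrite -subr_sqr ab addrAC subrr add0r.
  move=> e; have : 1 <= (b - a) * (2 * b) by nra.
  by nra.
by rewrite mulr_ge0 ?exprn_ge0 ?ltW.
Qed.

Lemma sum_LharmX_le K : exists2 B : R, 0 <= B &
  forall N, \sum_(M < N.+1) Lharm R[i] M ^+ K * M%:R ^- 2 <= B%:C%C.
Proof.
have [C C0 hC] := LharmX_le_sqrt K.
exists (C * 3) => [|N]; first by rewrite mulr_ge0.
have -> : \sum_(M < N.+1) Lharm R[i] M ^+ K * M%:R ^- 2 =
          (\sum_(M < N.+1) Lharm R M ^+ K * M%:R ^- 2)%:C%C.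
  rewrite rmorph_sum; apply: eq_bigr => M _.
  by rewrite Lharm_complex rmorphM fmorphV !rmorphXn /= rmorph_nat.
rewrite lecR; apply: (@le_trans _ _ (C * \sum_(M < N.+2) Num.sqrt (M%:R : R) * M%:R ^- 2)).
  rewrite mulr_sumr [leRHS]big_ord_recr /= ler_wpDr //.
    by rewrite !mulr_ge0 ?sqrtr_ge0 ?invr_ge0 ?exprn_ge0.
  apply: ler_sum => -[[|M] ?] _ /=; first by rewrite expr2 mul0r invr0 !mulr0.
  by rewrite mulrA ler_wpM2r ?invr_ge0 ?exprn_ge0.
rewrite ler_wpM2l //; apply: le_trans (sum_sqrt_le N) _.
by rewrite gerDl oppr_le0 divr_ge0 // sqrtr_ge0.
Qed.

End LharmGrowth.

(** * Absolute bounds with at least two non-empty slots *)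

Section ZsumBounds.
Variables (R : realType) (n : nat).
Implicit Types (P : 'I_n -> argindex R) (Q : argindex R).

Lemma fact_csum_abs_ge0 P j m : 0 <= fact_csum (fun j => absidx (P j)) j m.
Proof. by rewrite mulr_ge0 ?ler0n // csum_abs_ge0. Qed.

Lemma norm_comp_sum_le (f g : 'I_n -> nat -> R[i]) M :
  (forall j m, `|f j m| <= g j m) -> `|comp_sum f M| <= comp_sum g M.
Proof.
move=> fg; rewrite !(comp_sumE _ (ltnSn M)) (le_trans (ler_norm_sum _ _ _)) //.
by apply: ler_sum => m _; rewrite normr_prod ler_prod // => j _; rewrite normr_ge0 fg.
Qed.

Lemma fact_csum_abs_le P j m : is_argindex (P j) ->
  fact_csum (fun j => absidx (P j)) j m <=
  Lharm R[i] m ^+ size (P j) * (if P j == [::] then (m == 0%N) : nat else pfact m)%:R.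
Proof.
move=> hP; rewrite /fact_csum; case: eqP => [->|/eqP Pj].
  by rewrite csum_nil expr0 mul1r; case: m => [|m]; rewrite ?fact0 ?mulr1 ?mulr0.
case: m => [|m].
  by rewrite csum0 -size_eq0 size_map size_eq0 (negPf Pj) !mulr0.
apply: le_trans (ler_wpM2l (ler0n _ _) (csum_abs_le _ hP (ltn0Sn m))) _.
by rewrite mulrCA factS natrM mulrAC mulfV ?pnatr_eq0 // mul1r.
Qed.

(** Empty slots contribute the polynomial [1], leaving a power whose exponent is the number of
    non-empty slots; from two on, [coef_pfact_pow] applies. The factors [Lharm] are all majorised at
    [M]. *)
Lemma comp_sum_abs_le P M : (forall j, is_argindex (P j)) ->
  (1 < #|[pred j | P j != [::]]|)%N ->
  comp_sum (fact_csum (fun j => absidx (P j))) M <=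
  Lharm R[i] M ^+ (\sum_j size (P j)) * (3 ^ n * ppfact M)%:R.
Proof.
move=> hP hcard.
pose tau j m : R[i] := (if P j == [::] then (m == 0%N) : nat else pfact m)%:R.
apply: (@le_trans _ _ (Lharm R[i] M ^+ (\sum_j size (P j)) * comp_sum tau M)).
  rewrite !(comp_sumE _ (ltnSn M)) mulr_sumr; apply: ler_sum => m _.
  rewrite expr_sum -big_split /=; apply: ler_prod => j _.
  rewrite fact_csum_abs_ge0 (le_trans (fact_csum_abs_le _ _)) //.
  by rewrite ler_wpM2r ?ler0n // LharmX_le // -ltnS.
rewrite ler_wpM2l ?LharmX_ge0 // /comp_sum (bigID (fun j => P j == [::])) /=.
rewrite big1 ?mul1r; last first.
  move=> j /eqP Pj; apply/polyP => k; rewrite coef_poly coef1 /tau Pj eqxx.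
  by case: k => [|k]; [|case: ifP].
rewrite (eq_bigr (fun=> \poly_(m < M.+1) (pfact m)%:R)); last first.
  by move=> j /negPf Pj; apply/polyP => k; rewrite !coef_poly /tau Pj.
rewrite prodr_const.
have cn : (#|[pred j | P j != [::]]| <= n)%N.
  by rewrite -[leqRHS]card_ord max_card.
move: hcard cn; case: #|_| => [|[|k]] // _ kn.
apply: le_trans (coef_pfact_pow _ _ (ltnSn M)) _.
by rewrite ler_nat leq_mul2r leq_exp2l // ltnW // orbT.
Qed.

Lemma ppfact_div_le M : (ppfact M)%:R / M`!%:R <= 2 * M%:R ^- 2 :> R[i].
Proof.
case: M => [|[|M]]; rewrite ?mul0r ?mulr_ge0 ?invr_ge0 ?exprn_ge0 //=.
rewrite !factS mulnA natrM invfM mulrCA mulfV ?mulr1; last first.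
  by rewrite pnatr_eq0 -lt0n fact_gt0.
rewrite ler_pdivlMr ?exprn_gt0 ?ltr0n // mulrC ler_pdivrMr ?ltr0n //.
rewrite -natrX -natrM ler_nat mulnCA -mulnn leq_mul2l /=.
by rewrite mul2n -addnn addSnnS leq_addl.
Qed.

Lemma mul_csum_abs_le w Q m : is_argindex Q ->
  m%:R * csum w (absidx Q) m <= Lharm R[i] m ^+ size Q.
Proof.
move=> hQ; case: m => [|m]; first by rewrite mul0r LharmX_ge0.
by rewrite mulrC -ler_pdivlMr ?ltr0n // csum_abs_le.
Qed.

Lemma Zsum_le P Q (C : R) K : 0 <= C ->
  (forall M, comp_sum (fact_csum P) M / M`!%:R * (M%:R * csum true Q M) <=
     C%:C%C * (Lharm R[i] M ^+ K * M%:R ^- 2)) ->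
  exists B : R, forall N, Zsum P Q N <= B%:C%C.
Proof.
move=> C0 h; have [B B0 hB] := sum_LharmX_le R K.
exists (C * B) => N; rewrite /Zsum rmorphM /=.
apply: (@le_trans _ _ (C%:C%C * \sum_(M < N.+1) Lharm R[i] M ^+ K * M%:R ^- 2)).
  by rewrite mulr_sumr; apply: ler_sum => M _; exact: h.
by rewrite ler_wpM2l // ler0c.
Qed.

Lemma Zsum_abs_bounded P Q : (forall j, is_argindex (P j)) -> is_argindex Q ->
  (1 < #|[pred j | P j != [::]]|)%N ->
  exists B : R, forall N, Zsum (fun j => absidx (P j)) (absidx Q) N <= B%:C%C.
Proof.
move=> hP hQ hcard.
(* [3 ^ n] comes from [comp_sum_abs_le] and [2] from [ppfact_div_le]; the tail contributes only
   powers of [Lharm]. *)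
apply: (@Zsum_le _ _ (3 ^ n * 2)%:R (\sum_j size (P j) + size Q)) => [|M].
  exact: ler0n.
have := comp_sum_abs_le M hP hcard => h.
rewrite exprD rmorph_nat natrM.
apply: (@le_trans _ _ (Lharm R[i] M ^+ (\sum_j size (P j)) * (3 ^ n * ppfact M)%:R / M`!%:R *
   Lharm R[i] M ^+ size Q)).
  apply: ler_pM; rewrite ?mul_csum_abs_le //.
  - rewrite divr_ge0 // (le_trans _ (norm_comp_sum_le (f := fun _ _ => 0) _ _)) //.
    by move=> j m; rewrite normr0 fact_csum_abs_ge0.
  - by rewrite mulr_ge0 // csum_abs_ge0.
  - by rewrite ler_wpM2r // invr_ge0 ler0n.
rewrite natrM.
have := ppfact_div_le M.
set a := Lharm _ _ ^+ _; set b := Lharm _ _ ^+ _; set p := (ppfact M)%:R.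
move=> hp; rewrite [leLHS](_ : _ = (3 ^ n)%:R * (a * b) * (p / M`!%:R)); last by ring.
rewrite [leRHS](_ : _ = (3 ^ n)%:R * (a * b) * (2 * M%:R ^- 2)); last by ring.
by rewrite ler_wpM2l // !mulr_ge0 ?LharmX_ge0 ?ler0n.
Qed.

End ZsumBounds.

(** * Extra decay for two slots of which one is empty, and the boundary term *)

Lemma geometric_decay (F : numFieldType) (rho : F) (x y B : nat -> F) :
  0 <= rho < 1 -> (forall m, 0 <= x m) -> (forall m, 0 <= B m <= B m.+1) ->
  y 1%N <= B 1%N ->
  (forall m, (0 < m)%N -> y m.+1 <= rho * y m + x m) ->
  (forall m, (0 < m)%N -> m%:R * x m <= B m.+1) ->
  forall m, (0 < m)%N -> m%:R * y m <= (1 + (1 - rho)^-1) / (1 - rho) * B m.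
Proof.
move=> /andP[r0 r1] x0 hB y1 hy hx.
have B0 m : 0 <= B m by case/andP: (hB m).
have BS m : B m <= B m.+1 by case/andP: (hB m).
have q0 : 0 < 1 - rho by rewrite subr_gt0.
have qn : 1 - rho != 0 by rewrite gt_eqF.
have q1 : 1 <= (1 - rho)^-1 by rewrite invf_ge1 // gerBl.
(* [A / (1 - rho)] is the fixed point of [C -> rho * C + A], so the bound propagates along the
   recurrence. *)
have step (A : F) (Y : nat -> F) : 1 <= A -> Y 1%N <= B 1%N ->
    (forall m, (0 < m)%N -> Y m.+1 <= rho * Y m + A * B m.+1) ->
    forall m, (0 < m)%N -> Y m <= A / (1 - rho) * B m.
  move=> A1 Y1 hY; have A0 : 0 <= A := le_trans ler01 A1.
  have C0 : 0 <= A / (1 - rho) by rewrite divr_ge0 // ltW.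
  elim=> [//|[_ _|m IH _]].
    by rewrite (le_trans Y1) // ler_peMl // mulr_ege1.
  apply: le_trans (hY _ _) _ => //.
  apply: (@le_trans _ _ (rho * (A / (1 - rho) * B m.+2) + A * B m.+2)).
    by rewrite lerD2r ler_wpM2l // (le_trans (IH _)) // ler_wpM2l.
  by rewrite le_eqVlt; apply/orP; left; apply/eqP; field.
(* First use, for [y] itself: [x m <= m * x m <= B m.+1]. *)
have hy1 : forall m, (0 < m)%N -> y m <= (1 - rho)^-1 * B m.
  move=> m m0; rewrite -[(1 - rho)^-1]mul1r; apply: step m0 => // {}m m0.
  rewrite mul1r (le_trans (hy _ m0)) // lerD2l (le_trans _ (hx _ m0)) //.
  by rewrite ler_peMl // ler1n.
(* Second use, for [m * y m]: the extra [y m.+1] in [(m + 1) * y m.+1] is bounded by the first use,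
   whence [A = 1 + 1 / (1 - rho)]. *)
apply: (step _ (fun m => m%:R * y m)); rewrite ?mul1r //.
  by rewrite lerDl (le_trans _ q1).
move=> m m0; rewrite -[m.+1]addn1 natrD mulrDl mul1r addn1.
apply: (@le_trans _ _ (m%:R * (rho * y m + x m) + (1 - rho)^-1 * B m.+1)).
  by rewrite lerD ?hy1 // ler_wpM2l // hy.
rewrite mulrDr mulrCA -addrA lerD2l [leRHS]mulrDl mul1r lerD2r.
exact: hx.
Qed.

Section Exceptional.
Variables (R : realType) (n : nat).
Implicit Types (P : 'I_n -> argindex R) (Q : argindex R).

(** The hypothesis on [i] and [j] makes them the only slots. With slot [i] empty the whole total
    falls on slot [j], and [M!] cancels. *)
Lemma Zsum_bounded_single P Q (i j : 'I_n) (C : R) K :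
  P i = [::] -> (forall k, (k != i) = (k == j)) -> 0 <= C ->
  (forall M, (0 < M)%N -> csum false (P j) M * (M%:R * csum true Q M) <=
     C%:C%C * (Lharm R[i] M ^+ K * M%:R ^- 2)) ->
  exists B : R, forall N, Zsum P Q N <= B%:C%C.
Proof.
move=> Pi kij C0 h; apply: (Zsum_le C0) => -[|M].
  by rewrite mul0r mulr0 !mulr_ge0 ?ler0c // ?LharmX_ge0 ?invr_ge0 ?exprn_ge0.
rewrite /comp_sum (bigD1 i) //= (eq_bigl _ _ kij) big_pred1_eq.
have -> : \poly_(m < M.+2) fact_csum P i m = 1.
  apply/polyP => k; rewrite coef_poly coef1 /fact_csum Pi csum_nil.
  by case: k => [|k]; rewrite ?fact0 ?mulr1 ?mulr0 //; case: ifP.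
rewrite mul1r coef_poly ltnSn /fact_csum [_ / _]mulrAC mulfV ?mul1r; last first.
  by rewrite pnatr_eq0 -lt0n fact_gt0.
exact: h.
Qed.

Lemma decay_constant (z : R[i]) : `|z| < 1 ->
  exists2 C : R, 0 <= C & C%:C%C = (1 + (1 - `|z|)^-1) / (1 - `|z|).
Proof.
move=> z1; have q0 : 0 <= 1 - `|z| by rewrite subr_ge0 ltW.
have /ger0_real cr : 0 <= (1 + (1 - `|z|)^-1) / (1 - `|z|).
  by rewrite divr_ge0 // addr_ge0 // invr_ge0.
exists (complex.Re ((1 + (1 - `|z|)^-1) / (1 - `|z|))); last exact: RRe_real.
by rewrite -ler0c RRe_real // divr_ge0 // addr_ge0 // invr_ge0.
Qed.

Lemma csum_arrow_decay (P : argindex R) v : is_argindex P -> v != 0 -> `|v| < 1 ->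
  exists2 C : R, 0 <= C & forall m, (0 < m)%N ->
  m%:R ^+ 2 * csum false (absidx (idx_arrow v P)) m <= C%:C%C * Lharm R[i] m ^+ size P.
Proof.
move=> hP v0 v1.
have [C C0 eC] := decay_constant v1.
exists C => // m m0; rewrite eC expr2 -mulrA.
apply: (@geometric_decay _ `|v| (fun m => `|v| * csum false (absidx P) m)
  (fun m => m%:R * csum false (absidx (idx_arrow v P)) m)
  (fun m => Lharm R[i] m ^+ size P)) m0.
- by rewrite normr_ge0.
- by move=> k; rewrite mulr_ge0 // csum_abs_ge0.
- by move=> k; rewrite LharmX_ge0 LharmX_le.
- rewrite absidx_arrow csum_arrow_succ ?normr_eq0 // mul0r addr0.
  apply: le_trans (LharmX_ge1 _ _ _); rewrite mulr_ile1 ?csum_abs_ge0 ?(ltW v1) //.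
  by rewrite csum0; case: (_ == _).
- by move=> k _; rewrite absidx_arrow csum_arrow_succ ?normr_eq0 // addrC mulrDr.
- move=> k _; apply: le_trans (LharmX_le _ (leqnSn k) (leqnn (size P))).
  apply: le_trans (mul_csum_abs_le false k hP); rewrite ler_wpM2l //.
  by rewrite ler_piMl ?csum_abs_ge0 // ltW.
Qed.

Lemma arrow_tail_decay Q t : is_argindex Q -> `|t| < 1 ->
  exists2 C : R, 0 <= C & forall m, (0 < m)%N ->
  m%:R ^+ 2 * csum true (absidx (idx_arrow t Q)) m <= C%:C%C * Lharm R[i] m ^+ (size Q).+1.
Proof.
move=> hQ t1.
have [C C0 eC] := decay_constant t1.
exists C => // m m0; rewrite eC expr2 -mulrA.
apply: (@geometric_decay _ `|t| (fun m => csum true (absidx Q) m.+1)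
  (fun m => m%:R * csum true (absidx (idx_arrow t Q)) m)
  (fun m => Lharm R[i] m ^+ (size Q).+1)) m0.
- by rewrite normr_ge0.
- by move=> k; rewrite csum_abs_ge0.
- by move=> k; rewrite LharmX_ge0 LharmX_le.
(* The exponent [(size Q).+1] leaves room for the column that the arrow may add. *)
- apply: le_trans (mul_csum_abs_le _ _ (is_argindex_arrow (ltW t1) hQ)) _.
  apply: LharmX_le => //; rewrite /idx_arrow; case: ifP => _; last by rewrite size_rcons.
  by case/lastP: (Q) => [//|q c]; rewrite idx_up_rcons !size_rcons.
- by move=> k k0; rewrite absidx_arrow -/(arrow_tail _ _ _) arrow_tail_succ.
- move=> k _; apply: le_trans (LharmX_le _ (leqnn _) (leqnSn (size Q))).
  apply: le_trans (mul_csum_abs_le true k.+1 hQ).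
  by rewrite ler_wpM2r ?csum_abs_ge0 // ler_nat.
Qed.

Lemma boundary_cvg0 P Q t : (forall j, is_argindex (P j)) -> is_argindex Q ->
  `|t| <= 1 -> (1 < #|[pred j | P j != [::]]|)%N ->
  ((fun N => t * comp_sum (fact_csum P) N.+1 / N`!%:R * arrow_tail t Q N : R[i]^o)
    @ \oo --> (0 : R[i]^o))%classic.
Proof.
move=> hP hQ t1 hcard.
pose K := (\sum_j size (P j) + size (idx_arrow t Q))%N.
have [C C0 hC] := LharmX_le_sqrt R K.
(* [3 ^ n] comes from [comp_sum_abs_le], where [ppfact N.+1 / N! = 1 / N]; the powers of [Lharm]
   cost [C sqrt(N+1)], and [2] comes from [N + 1 <= 2 N]. *)
pose D : R := (3 ^ n)%:R * C * 2.
have D0 : 0 <= D by rewrite !mulr_ge0 ?ler0n.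
have cD : ((fun N => D * Num.sqrt (N.+1%:R^-1)) @ \oo --> (0 : R))%classic.
  have cS : ((fun N => Num.sqrt (@harmonic R N)) @ \oo --> Num.sqrt (0 : R))%classic.
    apply: (@cvg_comp _ _ _ (@harmonic R) Num.sqrt _ _ _ (@cvg_harmonic R)).
    exact: sqrt_continuous.
  rewrite -[X in (_ --> X)%classic](mulr0 D) -[X in D * X]sqrtr0.
  by apply: cvgM => //; exact: cvg_cst.
have bound N : (0 < N)%N ->
    `|t * comp_sum (fact_csum P) N.+1 / N`!%:R * arrow_tail t Q N| <=
    (D * Num.sqrt (N.+1%:R^-1))%:C%C.
  case: N => [//|N] _.
  have f0 : 0 < N.+1`!%:R :> R[i] by rewrite ltr0n fact_gt0.
  have h1 : `|comp_sum (fact_csum P) N.+2| <=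
      Lharm R[i] N.+2 ^+ (\sum_j size (P j)) * (3 ^ n * N`!)%:R.
    apply: le_trans (comp_sum_abs_le N.+2 hP hcard); apply: norm_comp_sum_le => j m.
    by rewrite /fact_csum normrM normr_nat ler_wpM2l ?ler0n // norm_csum_le.
  have h2 : `|arrow_tail t Q N.+1| <= Lharm R[i] N.+2 ^+ size (idx_arrow t Q).
    rewrite /arrow_tail normrM normr_nat.
    apply: (@le_trans _ _ (N.+1%:R * csum true (absidx (idx_arrow t Q)) N.+1)).
      by rewrite ler_wpM2l ?ler0n // norm_csum_le.
    rewrite (le_trans (mul_csum_abs_le _ _ (is_argindex_arrow t1 hQ))) //.
    exact: LharmX_le.
  rewrite !normrM normfV normr_nat.
  apply: (@le_trans _ _ (Lharm R[i] N.+2 ^+ (\sum_j size (P j)) * (3 ^ n * N`!)%:R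
     / N.+1`!%:R * Lharm R[i] N.+2 ^+ size (idx_arrow t Q))).
    apply: ler_pM => //; last by move: h2; rewrite /arrow_tail normrM.
    rewrite ler_wpM2r ?invr_ge0 ?ler0n // (le_trans _ h1) //.
    by rewrite ler_piMl.
  have reorder (a b c f : R[i]) : a * c * f * b = a * b * (c * f) by ring.
  rewrite reorder -exprD -/K.
  have -> : (3 ^ n * N`!)%:R / N.+1`!%:R = (3 ^ n)%:R / N.+1%:R :> R[i].
    by rewrite factS !natrM invfM mulrACA mulfV ?mulr1 // pnatr_eq0 -lt0n fact_gt0.
  rewrite Lharm_complex -rmorphXn /= -!(rmorph_nat (real_complex R)) -fmorphV -!rmorphM /= lecR.
  apply: le_trans (ler_wpM2r _ (hC N.+1)) _; first by rewrite divr_ge0.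
  have reorder' (a b c f : R) : a * b * (c * f) = c * a * (b * f) by ring.
  rewrite reorder' /D -[leRHS]mulrA ler_wpM2l ?mulr_ge0 ?ler0n //.
  have s0 : 0 < Num.sqrt N.+2%:R :> R by rewrite sqrtr_gt0 ltr0n.
  rewrite sqrtrV ?ler0n // ler_pdivrMr ?ltr0n // mulrAC ler_pdivlMr //.
  by rewrite -expr2 sqr_sqrtr ?ler0n // -natrM ler_nat mul2n -addnn addSnnS leq_addl.
apply/cvgrPdist_lt => e e0.
have er : e = (complex.Re e)%:C%C by rewrite RRe_real // gtr0_real.
have e0' : 0 < complex.Re e by rewrite -ltcR -er.
move/cvgrPdist_lt : cD => /(_ _ e0') [N0 _ hN0].
exists N0.+1 => // N /= N0N; rewrite sub0r normrN.
apply: le_lt_trans (bound N _) _; first exact: leq_ltn_trans N0N.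
rewrite er ltcR; apply: le_lt_trans (hN0 N (ltnW N0N)).
by rewrite sub0r normrN ler_norm.
Qed.

End Exceptional.

(** One of the two factors decays like [M^-2], the other at least like [M^-1], up to powers of
    [Lharm]; the weight [q_s = M] cancels one power, which leaves [M^-2]. *)
Lemma exceptional_bounded (R : realType) (n : nat) (P : 'I_n -> argindex R)
  (Q : argindex R) (i j : 'I_n) (C : R) (K : nat) :
  (forall k, is_argindex (P k)) -> is_argindex Q ->
  P i = [::] -> (forall k, (k != i) = (k == j)) -> 0 <= C ->
  (forall m, (0 < m)%N ->
     m%:R ^+ 2 * csum false (absidx (P j)) m <= C%:C%C * Lharm R[i] m ^+ K) \/
  (forall m, (0 < m)%N ->
     m%:R ^+ 2 * csum true (absidx Q) m <= C%:C%C * Lharm R[i] m ^+ K) ->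
  exists B : R, forall N, Zsum (fun k => absidx (P k)) (absidx Q) N <= B%:C%C.
Proof.
move=> hP hQ Pi kij C0 hC.
have key (a b x y z : R[i]) : 0 <= a -> 0 <= b -> 0 <= x -> 0 < z -> z ^+ 2 * a <= C%:C%C * x ->
    z * b <= y -> a * (z * b) <= C%:C%C * (x * y * z ^- 2).
  move=> a0 b0 x0 z0 ha hb.
  rewrite [leRHS]mulrA ler_pdivlMr ?exprn_gt0 // [leLHS]mulrC [leLHS]mulrA [leRHS]mulrA.
  by apply: ler_pM => //; rewrite mulr_ge0 ?exprn_ge0 ?(ltW z0).
apply: (@Zsum_bounded_single _ _ _ _ i j C (K + (size Q + size (P j)))) => //.
  by rewrite Pi.
move=> M M0; have zM : 0 < M%:R :> R[i] by rewrite ltr0n.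
have tail w q : is_argindex q -> (size q <= size Q + size (P j))%N ->
    M%:R * csum w (absidx q) M <= Lharm R[i] M ^+ (size Q + size (P j)).
  by move=> hq sq; rewrite (le_trans (mul_csum_abs_le w M hq)) // LharmX_le.
rewrite exprD; case: hC => hC.
  by apply: key; rewrite ?csum_abs_ge0 ?LharmX_ge0 ?hC ?tail ?leq_addr.
rewrite mulrCA [csum false _ _ * _]mulrC mulrCA.
by apply: key; rewrite ?csum_abs_ge0 ?LharmX_ge0 ?hC ?tail ?leq_addl.
Qed.

(** * Absolute convergence of all series and passage to the limit *)

Unset Implicit Arguments.
Set Strict Implicit.

Theorem theorem2p4 (R : realType) (n d : nat)
  (hn : (2 <= n)%N) (hd : (1 <= d <= n)%N)
  (P : 'I_n -> argindex R) (Q : argindex R) (v : 'I_n -> R[i]) (t : R[i])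
  (hP : forall i, is_argindex (P i))
  (hPne : forall i : 'I_n, (d <= i)%N -> P i <> [::])
  (hQ : is_argindex Q)
  (hv : forall i : 'I_n, (i < d)%N -> `|v i| <= 1 /\ v i <> 0)
  (ht : `|t| <= 1)
  (hvt : \sum_(i < n | (i < d)%N) (v i)^-1 = t)
  (hcvg : n = 2%N -> d = 2%N ->
     forall i : 'I_n, P i = [::] -> `|v (rev_ord i)| < 1 \/ `|t| < 1) :
  let full := fun j : 'I_n =>
    if (j < d)%N then idx_arrow (v j) (P j) else idx_up (P j) in
  let slot := fun i j : 'I_n => if j == i then P j else full j in
  [/\ forall i : 'I_n, Zn_abs_cvg (slot i) (idx_arrow t Q),
      Zn_abs_cvg full Q &
      \sum_(i < n | (i < d)%N) Zn (slot i) (idx_arrow t Q)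
        - \sum_(i < n | (d <= i)%N) Zn (slot i) (idx_arrow t Q)
      = - Zn full Q].
Proof.
move=> full slot.
have v0 (i : 'I_n) : (i < d)%N -> v i != 0 by move=> /hv[_ /eqP].
have hfull j : is_argindex (full j).
  rewrite /full; case: ifP => [/hv[v1 _]|_]; first exact: is_argindex_arrow.
  exact: is_argindex_up.
have hslot i j : is_argindex (slot i j) by rewrite /slot; case: eqP.
have full_neq0 j : full j != [::].
  rewrite -size_eq0 /full; case: ltnP => [/v0/negPf jd|/hPne].
    by rewrite /idx_arrow jd size_rcons.
  by case/lastP: (P j) => [//|p c _]; rewrite idx_up_rcons size_rcons.
have hQt : is_argindex (idx_arrow t Q) by exact: is_argindex_arrow.
have card_full : (1 < #|[pred j | full j != [::]]|)%N.
  by rewrite (@eq_card _ _ predT) ?card_ord // => j; rewrite !inE full_neq0.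
have slot_bounded i : exists B : R, forall N,
    Zsum (fun j => absidx (slot i j)) (absidx (idx_arrow t Q)) N <= B%:C%C.
  (* Arrowed slots are non-empty, so only the bare slot [i] can be empty; two non-empty slots remain
     unless [n = 2]. *)
  have [Pi|Pi] := eqVneq (P i) [::]; last first.
    apply: Zsum_abs_bounded => //.
    rewrite (@eq_card _ _ predT) ?card_ord // => j; rewrite !inE /slot.
    by have [->|_] := eqVneq j i; rewrite ?Pi ?full_neq0.
  have [n3|n2] := ltnP 2 n.
    apply: Zsum_abs_bounded => //; apply: (@leq_trans #|predC1 i|).
      by rewrite cardC1 card_ord -ltnS prednK // (ltn_trans _ n3).
    apply/subset_leq_card/fintype.subsetP => j; rewrite !inE /slot.
    by move=> /negPf ->; exact: full_neq0.
  have {n2}n2 : n = 2%N by apply/eqP; rewrite eqn_leq n2.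
  pose j := rev_ord i.
  have kij k : (k != i) = (k == j).
    have := ltn_ord i; have := ltn_ord k; rewrite -!val_eqE /=.
    by move: (k : nat) (i : nat) => a b; rewrite n2; case: a b => [|[|?]] [|[|?]].
  have slot_i : slot i i = [::] by rewrite /slot eqxx.
  have slot_j : slot i j = full j.
    by rewrite /slot; have := kij j; rewrite eqxx => /negPf ->.
  have id : (i < d)%N by rewrite ltnNge; apply/negP => /hPne.
  have [jd|dj] := ltnP j d; last first.
    (* Here the other slot carries [idx_up], which supplies the extra [1 / m]. *)
    apply: (@exceptional_bounded _ _ _ _ i j 1 (size (P j))) => //; left => m m0.
    have Pj : P j != [::] by apply/eqP/hPne.
    rewrite slot_j /full ltnNge dj /= absidx_up csum_up; last first.
      by rewrite -size_eq0 size_map size_eq0.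
    rewrite mul1r expr2 -mulrA [_ * (_ / _)]mulrC divfK ?pnatr_eq0 -?lt0n //.
    exact: mul_csum_abs_le.
  have d2 : d = 2%N.
    case/andP: hd => d1; rewrite n2 leq_eqVlt ltnS => /orP[/eqP//|d1'].
    have de : d = 1%N by apply/eqP; rewrite eqn_leq d1 d1'.
    have := kij j; rewrite eqxx => /eqP[]; apply/val_inj.
    by move: id jd; rewrite de !ltnS !leqn0 => /eqP ii /eqP jj; apply: etrans jj _.
  (* Geometric decay comes from [v] at the other slot [rev_ord i], or from [t]. *)
  case: (hcvg n2 d2 i Pi) => [vj|t1].
    have [C C0 hC] := csum_arrow_decay (hP j) (v0 _ jd) vj.
    apply: (@exceptional_bounded _ _ _ _ i j C (size (P j))) => //; left => m m0.
    by rewrite slot_j /full jd; exact: hC.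
  have [C C0 hC] := arrow_tail_decay hQ t1.
  by apply: (@exceptional_bounded _ _ _ _ i j C (size Q).+1) => //; right.
have slot_cvg i : Zn_abs_cvg (slot i) (idx_arrow t Q) /\
    ((Zsum (slot i) (idx_arrow t Q) : nat -> R[i]^o) @ \oo -->
     (Zn (slot i) (idx_arrow t Q) : R[i]^o))%classic.
  by have [B hB] := slot_bounded i; exact: Zn_cvg hB.
have [B hB] := Zsum_abs_bounded hfull hQ card_full.
have [full_abs full_cvg] := Zn_cvg hB.
split=> //; first by move=> i; case: (slot_cvg i).
have sum_cvg (p : pred 'I_n) :
    ((fun N => \sum_(i < n | p i) Zsum (slot i) (idx_arrow t Q) N : R[i]^o) @ \oo -->
     (\sum_(i < n | p i) Zn (slot i) (idx_arrow t Q) : R[i]^o))%classic.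
  rewrite -[X in (X @ _ --> _)%classic](_ : \sum_(i < n | p i)
    (Zsum (slot i) (idx_arrow t Q) : nat -> R[i]^o) = _); last first.
    by apply/funext => N; rewrite fct_sumE.
  elim/big_ind2: _ => [|f x g y|i _]; [exact: cvg_cst|exact: cvgD|].
  by case: (slot_cvg i).
have lhs_cvg := cvgB (FF := eventually_filter)
  (sum_cvg (fun i : 'I_n => (i < d)%N)) (sum_cvg (fun i : 'I_n => (d <= i)%N)).
have rhs_cvg := cvgB (FF := eventually_filter)
  (boundary_cvg0 hfull hQ ht card_full) full_cvg.
rewrite sub0r in rhs_cvg.
apply: etrans (esym (cvg_lim (@norm_hausdorff _ R[i]^o) lhs_cvg)) _.
apply: cvg_lim; first exact: norm_hausdorff.
apply: cvg_trans rhs_cvg; apply: near_eq_cvg.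
(* The truncated identity holds from [N = 1] on, which suffices for the limit. *)
exists 1%N => // N /= N0; rewrite !fctE.
by rewrite -(truncated_identity Q hn hPne v0 hvt N0).
Qed.
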